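(* Let $(X,f)$ be a cascade and let $\mathcal L$ be an $f^*$ +invariant sufficient set of Lyapunov functions for $f$. Let $(\hat X,\hat f)$ be the associated Lyapunov function cascade compactification. Define $\tilde X=\bigcup_{n\in\mathbb Z_+}\hat f^{-n}(X)$. (a) $(\hat X,\hat f)$ is a dynamic cascade compactification with $|\mathcal G\hat f|\cap(\hat X\setminus\tilde X)\subset|\hat f|$. (b) If $\hat E\subset|\mathcal G\hat f|$ is a $\mathcal G\hat f\cap\mathcal G\hat f^{-1}$ equivalence class with $E=\hat E\cap X$, then exactly one of the following three possibilities holds: (i) $\hat E$ consists of a single fixed point of $\hat f$ contained in $\hat X\setminus\tilde X$, and $E=\emptyset$. (ii) $E$ is contained in $|\mathcal Gf|$ and is a noncompact $\mathcal Gf\cap\mathcal Gf^{-1}$ equivalence class, and $\hat E\cap(\hat X\setminus\tilde X)$ is a single fixed point of $\hat f$. (iii) $\hat E=E$ is contained in $|\mathcal Gf|$ and is a compact $\mathcal Gf\cap\mathcal Gf^{-1}$ equivalence class. (c) If $f$ is a proper map on $X$ then $X=\tilde X$ and $(\hat X,\hat f)$ is the $\mathcal L$ compactification. (d) If $f$ is a homeomorphism and $\mathcal L$ is $f^*$ invariant, then the $\mathcal L$ compactification $(\hat X,\hat f)$ is a reversible cascade (i.e. $\hat f$ is a homeomorphism). (e) If $X$ is metrizable and/or $f$ is reversible (a homeomorphism), then there exist Lyapunov function cascade compactifications for $(X,f)$ with the same properties (i.e. with $\hat X$ metrizable and/or $\hat f$ a homeomorphism, respectively).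
   Context: A space is a locally compact, $\sigma$-compact Hausdorff space. A cascade $(X,f)$ is a space $X$ with a continuous map $f:X\to X$ (identified with its graph, a closed relation on $X$). For a relation $g$ on $X$: $g^{-1}$ is the reverse relation, $|g|=\{x:(x,x)\in g\}$ (for a map, its fixed point set), $1_X$ is the diagonal. $\mathcal Gg$ is the smallest closed transitive relation on $X$ containing $g$; $\mathcal Gg^{-1}=(\mathcal Gg)^{-1}$, and $\mathcal Gg\cap\mathcal Gg^{-1}$ restricts to an equivalence relation on $|\mathcal Gg|$, whose classes are the $\mathcal Gg\cap\mathcal Gg^{-1}$ equivalence classes. A continuous map is proper if preimages of compact sets are compact. $\mathcal B(X)$ is the Banach algebra of bounded continuous real functions on $X$ with the sup norm; $f^*(u)=u\circ f$. A subset $\mathcal K\subset\mathcal B(X)$ is $f^*$ +invariant if $f^*(\mathcal K)\subset\mathcal K$ and $f^*$ invariant if $f^*(\mathcal K)=\mathcal K$. A proper compactification of $X$ is a compact Hausdorff $\hat X$ containing $X$ as a dense (hence open) topological subspace; it corresponds to the closed subalgebra of functions in $\mathcal B(X)$ extending continuously to $\hat X$, and every closed subalgebra (containing the constants) distinguishing points from closed sets arises from a unique (up to homeomorphism) such $\hat X$. $\hat f$ is the closure of $f$ in $\hat X\times\hat X$. $(\hat X,\hat f)$ is a cascade compactification if $\hat f$ is a (necessarily continuous) map on $\hat X$, and it is dynamic if it is proper and $\mathcal G\hat f\cap(X\times X)=\mathcal Gf$. A Lyapunov function for $f$ is $L\in\mathcal B(X)$ with $L(x)\le L(f(x))$ for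 all $x$. With $\le_L=\{(x,y):L(x)\le L(y)\}$, a set $\mathcal L$ of Lyapunov functions is sufficient if $1_X\cup\mathcal Gf=\bigcap_{L\in\mathcal L}\le_L$. The $\mathcal L$ compactification is the one associated with the closed subalgebra generated by $\mathcal L$ and the continuous functions of compact support. For $\mathcal L$ an $f^*$ +invariant sufficient set, the associated Lyapunov function cascade compactification is the one associated with the closed subalgebra generated by $\mathcal L$ together with all $u\circ f^n$, $n\in\mathbb Z_+=\{0,1,2,\dots\}$, $u$ continuous of compact support. *)

(* Defs.v *)
From HB Require Import structures.
From mathcomp Require Import all_boot all_order all_algebra.
From mathcomp Require Import all_classical all_reals all_analysis.

Set Implicit Arguments.
Unset Strict Implicit.
Unset Printing Implicit Defensive.

Import Order.TTheory GRing.Theory Num.Theory.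
Import numFieldNormedType.Exports.

Local Open Scope classical_set_scope.
Local Open Scope ring_scope.

Definition sigma_compact (X : topologicalType) :=
  exists2 K : nat -> set X, (forall n, compact (K n)) & \bigcup_n K n = setT.

Definition lc_sigma_compact_hausdorff (X : topologicalType) :=
  [/\ locally_compact [set: X], sigma_compact X & hausdorff_space X].

Definition homeomorphism (T U : topologicalType) (h : T -> U) :=
  continuous h /\ exists g : U -> T, [/\ continuous g, cancel h g & cancel g h].

Definition metrizable (R : realType) (T : topologicalType) :=
  exists (M : metricType R) (h : T -> M), homeomorphism h.

Definition proper_map (T U : topologicalType) (h : T -> U) :=
  continuous h /\ forall K : set U, compact K -> compact (h @^-1` K).

Definition graph_of (X : Type) (f : X -> X) : set (X * X) :=
  [set p | f p.1 = p.2].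

Definition rel_fixed (X : Type) (r : set (X * X)) : set X :=
  [set x | r (x, x)].

Definition rel_preimage (X : Type) (r : set (X * X)) (A : set X) : set X :=
  [set x | exists2 y, A y & r (x, y)].

Definition rel_transitive (X : Type) (r : set (X * X)) :=
  forall x y z, r (x, y) -> r (y, z) -> r (x, z).

Definition GG (X : topologicalType) (r : set (X * X)) : set (X * X) :=
  smallest [set s | closed s /\ rel_transitive s] r.

Definition GG_class (X : topologicalType) (r : set (X * X)) (E : set X) :=
  exists2 x, rel_fixed (GG r) x &
    E = [set y | rel_fixed (GG r) y /\ (GG r `&` (GG r)^-1)%relation (x, y)].

Definition bounded_continuous (R : realType) (X : topologicalType) :
    set (X -> R) :=
  [set u : X -> R | continuous u /\ bounded_fun u].

Definition compact_support (R : realType) (X : topologicalType) :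
    set (X -> R) :=
  [set u : X -> R | continuous u /\ compact (closure [set x | u x != 0])].

(** On [bounded_continuous], the sup-norm topology is the one induced by the
    topology of uniform convergence. *)
Definition closed_subalgebra (R : realType) (X : topologicalType)
    (A : set (X -> R)) :=
  [/\ A `<=` @bounded_continuous R X,
      forall c : R, A (cst c),
      forall u v, A u -> A v -> A (u \+ v),
      forall u v, A u -> A v -> A (u \* v) &
      @closed {uniform X -> R} A].

Definition generated_subalgebra (R : realType) (X : topologicalType)
    (S : set (X -> R)) : set (X -> R) :=
  smallest (@closed_subalgebra R X) S.

(** A compactification of [X] is given by the inclusion [i : X -> Xh]; a subset
    [A] of [Xh] meets [X] in [i @^-1` A], and [X] itself is [range i]. *)

Definition proper_compactification (X Xh : topologicalType) (i : X -> Xh) :=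
  [/\ compact [set: Xh] /\ hausdorff_space Xh,
      injective i,
      forall A : set X, open A <-> exists2 B : set Xh, open B & i @^-1` B = A &
      dense (range i)].

Definition extendable (R : realType) (X Xh : topologicalType) (i : X -> Xh) :
    set (X -> R) :=
  [set u : X -> R | bounded_continuous u /\
           exists2 uh : Xh -> R, continuous uh & uh \o i = u].

(** This determines [Xh] only up to homeomorphism. *)
Definition associated_compactification (R : realType) (X Xh : topologicalType)
    (A : set (X -> R)) (i : X -> Xh) :=
  proper_compactification i /\ extendable i = A.

(** The closure of [f] in [Xh * Xh]; a priori only a relation. *)
Definition hat_rel (X Xh : topologicalType) (f : X -> X) (i : X -> Xh) :
    set (Xh * Xh) :=
  closure [set (i p.1, i p.2) | p in graph_of f].

Definition cascade_compactification (X Xh : topologicalType) (f : X -> X)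
    (i : X -> Xh) :=
  exists2 fh : Xh -> Xh, continuous fh & hat_rel f i = graph_of fh.

Definition reversible_cascade_compactification (X Xh : topologicalType)
    (f : X -> X) (i : X -> Xh) :=
  exists2 fh : Xh -> Xh, homeomorphism fh & hat_rel f i = graph_of fh.

Definition dynamic_compactification (X Xh : topologicalType) (f : X -> X)
    (i : X -> Xh) :=
  proper_compactification i /\
  [set p | GG (hat_rel f i) (i p.1, i p.2)] = GG (graph_of f).

(** The term of index [n] is the preimage of [X] under the [n]-th iterate of
    the relation [hat_rel f i]. *)
Definition tilde_space (X Xh : topologicalType) (f : X -> X) (i : X -> Xh) :
    set Xh :=
  \bigcup_n iter n (rel_preimage (hat_rel f i)) (range i).

Definition lyapunov_fun (R : realType) (X : topologicalType) (f : X -> X) :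
    set (X -> R) :=
  [set L : X -> R | bounded_continuous L /\ forall x, L x <= L (f x)].

Definition lyapunov_le (R : realType) (X : Type) (L : X -> R) : set (X * X) :=
  [set p | L p.1 <= L p.2].

Definition sufficient_set (R : realType) (X : topologicalType) (f : X -> X)
    (LL : set (X -> R)) :=
  LL `<=` @lyapunov_fun R X f /\
  @diagonal X `|` GG (graph_of f) = \bigcap_(L in LL) lyapunov_le L.

Definition plus_invariant (R : realType) (X : Type) (f : X -> X)
    (LL : set (X -> R)) :=
  [set u \o f | u in LL] `<=` LL.

Definition star_invariant (R : realType) (X : Type) (f : X -> X)
    (LL : set (X -> R)) :=
  [set u \o f | u in LL] = LL.

Definition L_compactification (R : realType) (X Xh : topologicalType)
    (LL : set (X -> R)) (i : X -> Xh) :=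
  associated_compactification
    (generated_subalgebra (LL `|` @compact_support R X)) i.

Definition lyapunov_compactification (R : realType) (X Xh : topologicalType)
    (f : X -> X) (LL : set (X -> R)) (i : X -> Xh) :=
  associated_compactification
    (generated_subalgebra
      (LL `|` [set u | exists n, exists2 v, @compact_support R X v &
                         u = v \o iter n f])) i.

Definition class_at_infinity (X Xh : topologicalType) (f : X -> X)
    (i : X -> Xh) (Eh : set Xh) :=
  exists e, [/\ Eh = [set e], rel_fixed (hat_rel f i) e, ~ tilde_space f i e &
                i @^-1` Eh = set0].

Definition class_noncompact (X Xh : topologicalType) (f : X -> X)
    (i : X -> Xh) (Eh : set Xh) :=
  [/\ i @^-1` Eh `<=` rel_fixed (GG (graph_of f)),
      GG_class (graph_of f) (i @^-1` Eh),
      ~ compact (i @^-1` Eh) &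
      exists2 e, rel_fixed (hat_rel f i) e & Eh `&` ~` tilde_space f i = [set e]].

Definition class_compact (X Xh : topologicalType) (f : X -> X)
    (i : X -> Xh) (Eh : set Xh) :=
  [/\ Eh = i @` (i @^-1` Eh),
      i @^-1` Eh `<=` rel_fixed (GG (graph_of f)),
      GG_class (graph_of f) (i @^-1` Eh) &
      compact (i @^-1` Eh)].

Definition exactly_one (P Q S : Prop) :=
  [\/ [/\ P, ~ Q & ~ S], [/\ ~ P, Q & ~ S] | [/\ ~ P, ~ Q & S]].

(* Main.v *)
Require Import Defs.
From HB Require Import structures.
From mathcomp Require Import all_boot all_order all_algebra.
From mathcomp Require Import all_classical all_reals all_analysis.
From mathcomp Require Import lra ring.
Import Order.TTheory GRing.Theory Num.Theory.
Import numFieldNormedType.Exports.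
Set Implicit Arguments.
Unset Strict Implicit.
Unset Printing Implicit Defensive.
Local Open Scope classical_set_scope.
Local Open Scope ring_scope.

(** A closed preorder on a locally compact sigma-compact space is determined by
    the bounded continuous functions that are monotone for it; for the preorder
    [1 `|` GG f] these are the Lyapunov functions. In the compactification, every
    Lyapunov function extends to one for the extension of [f], so it is constant
    on the classes of the extended relation; and a function [u \o iter n f] with
    [u] of compact support extends by [0] at the points that never enter [X].
    Since these functions generate the algebra, they separate points, and so a
    class has at most one point that never enters [X], which must be fixed. *)

(** * Tubes, projections and compact neighborhoods *)

(** When [f] is not proper, composition with [f] may destroy compactness of supports. The functions
    [u \o iter n f] are adjoined for this reason: with them the algebra is stable under composition
    with [f], and this turns the closure of the graph into the graph of a map. Sufficiency
    determines [GG] only up to the diagonal, so recurrence of a single point of [X] is recovered by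
    first taking one step along [f]. Pairs in [GG] cannot be followed along chains, because limits
    are taken again and again; their properties are obtained by exhibiting a closed transitive
    relation that contains the map. For (e), a sufficient family may be enlarged to its orbit under
    [f] and its inverse, and on a metrizable space sufficiency is a covering condition on an open
    sigma-compact subset of [X * X], so countably many functions are enough. *)

Section tube.
Context {X Y : topologicalType}.

(** The second factor enters through a filter so that both the neighborhoods of a point and those of
    a compact set can be used. *)
Lemma compact_tube (K : set X) (F : set_system Y) (W : set (X * Y)) :
  Filter F -> compact K ->
  (forall x, K x -> exists U V, [/\ nbhs x U, F V & U `*` V `<=` W]) ->
  exists U V, [/\ open U, K `<=` U, F V & U `*` V `<=` W].
Proof.
move=> FF /compact_near_coveringP cK h.
pose P (V : set Y) (x : X) := nbhs x [set x' | forall y, V y -> W (x', y)].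
(* The parameter of the near-covering property is a set that shrinks inside members of [F]: what
   holds eventually along [G] holds for one [V] in [F], uniformly on [K]. *)
pose G := filter_from F (fun V => [set V' : set Y | V' `<=` V]).
have FG : Filter G.
  apply: filter_from_filter; first by exists setT; exact: filterT.
  move=> V1 V2 FV1 FV2; exists (V1 `&` V2); first exact: filterI.
  by move=> V' /=; rewrite subsetI.
have := cK _ G P FG; case.
  move=> x /h[U [V [xU FV UVW]]].
  exists (U°, [set V' | V' `<=` V]) => /=.
    by split; [exact: nbhs_interior|exists V].
  move=> [x' V'] /= [Ux' V'V]; rewrite /P.
  by apply: filterS Ux' => z Uz y /V'V Vy; apply: UVW.
move=> V FV /(_ V (@subset_refl _ _)) MP.
exists [set x | forall y, V y -> W (x, y)]°, V; split.
- exact: open_interior.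
- by move=> x Kx; exact: MP.
- exact: FV.
- by case=> x y /= [] /interior_subset; apply.
Qed.

End tube.

Lemma compact_setX_tube (X Y : topologicalType) (A : set X) (B : set Y)
    (W : set (X * Y)) : compact A -> compact B -> open W -> A `*` B `<=` W ->
  exists U V, [/\ open U, open V, A `<=` U, B `<=` V & U `*` V `<=` W].
Proof.
move=> cA cB oW ABW.
have [x Ax|U [V [oU AU BV UVW]]] :=
  @compact_tube _ _ A (set_nbhs B) W _ cA.
  have [y By|V [U [oV BV xU VUW]]] :=
    @compact_tube _ _ B (nbhs x) [set yx | W (yx.2, yx.1)] _ cB.
    have := oW; rewrite openE => /(_ (x, y)) /=.
    move=> /(_ (ABW (x, y) (conj Ax By)))[[U V] /= [xU yV] UVW].
    exists V, U; split=> //; case=> y' x' /= [Vy Ux].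
    exact: (UVW (x', y')).
  exists U, V; split=> //; first by apply/set_nbhsP; exists V; split.
  by case=> x' y' /= [Ux Vy]; apply: (VUW (y', x')).
case/set_nbhsP: BV => V' [oV' BV' V'V].
exists U, V'; split=> //.
by apply: subset_trans UVW; apply: setSX.
Qed.

Lemma closed_proj (X Y : topologicalType) (P : set (X * Y)) (K : set Y) :
  closed P -> compact K -> closed [set x | exists2 y, K y & P (x, y)].
Proof.
move=> clP /compact_near_coveringP cK.
rewrite -openC openE => x /= nx.
have oP : open (~` P) by rewrite openC.
have : forall y, K y -> \forall y' \near y & x' \near nbhs x, ~ P (x', y').
  move=> y Ky; have := oP; rewrite openE => /(_ (x, y)) /=.
  move=> /(_ _)[Pxy|[U V] /= [xU yV] UVW]; first by apply: nx; exists y.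
  exists (V, U) => //= -[y' x'] /= [Vy Ux].
  exact: (UVW (x', y')).
move/(cK _ (nbhs x) (fun x' y => ~ P (x', y)) (nbhs_filter x)).
by apply: filterS => x' h /= [y /h].
Qed.

Lemma closed_diagonal (X : topologicalType) : hausdorff_space X ->
  closed (@diagonal X).
Proof.
move=> hX; rewrite -openC openE => -[x y] /= /eqP xy.
have := hX; rewrite open_hausdorff => /(_ x y xy)[[U V] /= [xU yV] [oU oV UV]].
exists (U, V) => /=; first by split; apply: open_nbhs_nbhs; split=> //; exact/set_mem.
move=> [a b] /= [Ua Vb] /diagonalP /= ab; move/eqP/disjoints_subset : UV.
by move=> /(_ a Ua); rewrite ab.
Qed.

Lemma compact_nbhd (X : topologicalType) (K O : set X) :
  locally_compact [set: X] -> hausdorff_space X -> compact K -> open O ->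
  K `<=` O -> exists K', [/\ compact K', K `<=` K'° & K' `<=` O].
Proof.
move=> lcX hX cK oO KO.
pose A (x : X) := [set U | [/\ nbhs x U, compact U & U `<=` O]].
have hA x : O x -> exists U, A x U.
  move=> Ox; have [C] := lcX x I; rewrite withinET => xC [cC clC].
  have xO : nbhs x O by exact: open_nbhs_nbhs.
  have [U xU UO] := compact_regular hX cC xC xO.
  exists (closure (U `&` C)); split.
  - by apply: filterS (@subset_closure _ _) _; exact: filterI.
  - apply: (subclosed_compact _ cC); first exact: closed_closure.
    by apply: subset_trans clC; apply: closureS; exact: subIsetr.
  - by apply: subset_trans UO; apply: closureS; exact: subIsetl.
move/compact_near_coveringP : cK.
(* Along [F] the parameter grows past every compact subset of [O]; finite unions make this a filter.
   One compact [U] is then a neighborhood of every point of [K]. *)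
pose F := filter_from [set U | compact U /\ U `<=` O] (fun U => [set V | U `<=` V]).
have FF : Filter F.
  apply: filter_from_filter; first by exists set0; split=> //; exact: compact0.
  move=> U V [cU UO] [cV VO]; exists (U `|` V).
    by split; [exact: compactU|rewrite subUset].
  by move=> W /=; rewrite subUset.
move=> /(_ _ F (fun V x => nbhs x V) FF) []; first move=> x Kx.
  have [U [xU cU UO]] := hA x (KO _ Kx).
  exists (U°, [set V | U `<=` V]) => /=.
    by split; [exact: nbhs_interior|exists U].
  by move=> [x' V] /= [Ux' UV]; exact: filterS Ux'.
move=> U [cU UO] h; exists U; split=> // x /(h U); exact.
Qed.

(** * Monotone functions on closed preorders *)

Definition lower_set (X : Type) (P : set (X * X)) (D : set X) :=
  forall x y, P (x, y) -> D y -> D x.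

Definition upper_set (X : Type) (P : set (X * X)) (D : set X) :=
  forall x y, P (x, y) -> D x -> D y.

Lemma increasing_compact_cover (X : topologicalType) : sigma_compact X ->
  exists K : nat -> set X, [/\ forall n, compact (K n),
    forall m n, (m <= n)%N -> K m `<=` K n & \bigcup_n K n = setT].
Proof.
move=> [K cK KT]; exists (fun n => \big[setU/set0]_(k < n.+1) K k); split.
- by move=> n; apply: bigsetU_compact.
- move=> m n mn x; rewrite -!bigcup_mkord => -[k /= km Kx].
  by exists k => //=; exact: leq_trans km _.
- rewrite -subTset -KT => x [k _ Kx]; exists k => //.
  by rewrite -bigcup_mkord; exists k => /=.
Qed.

Section normally_preordered.
Context {X : topologicalType} (P : set (X * X)).
Hypothesis lcX : locally_compact [set: X].
Hypothesis scX : sigma_compact X.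
Hypothesis hX : hausdorff_space X.
Hypothesis clP : closed P.
Hypothesis reflP : forall x, P (x, x).
Hypothesis transP : rel_transitive P.

Let clPV : closed [set p | P (p.2, p.1)].
Proof. by apply: preimage_closed => // p _; exact: swap_continuous. Qed.

Let below (A : set X) := [set x | exists2 y, A y & P (x, y)].
Let above (B : set X) := [set y | exists2 x, B x & P (x, y)].

Let closed_below A : compact A -> closed (below A).
Proof. exact: closed_proj. Qed.

Let closed_above A : compact A -> closed (above A).
Proof. exact: (closed_proj clPV). Qed.

(* [A] and [B] are exhausted by increasing compact sets [(S n).1] and [(S n).2],
   separated for the preorder: stage [n + 1] contains a neighborhood of the
   trace on [K n] of [A] and of the down-closure of stage [n], dually for [B].
   The traces are needed because only down-closures of compact sets are known
   to be closed. *)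
Lemma lower_upper_separation (A B : set X) : closed A -> lower_set P A ->
  closed B -> upper_set P B -> A `&` B = set0 ->
  exists V W, [/\ open V /\ lower_set P V, open W /\ upper_set P W,
                  A `<=` V, B `<=` W & V `&` W = set0].
Proof.
move=> clA dA clB uB AB0.
have nAB x : A x -> B x -> False.
  by move=> Ax Bx; have : (A `&` B) x by []; rewrite AB0.
have [K [cK incK KT]] := increasing_compact_cover scX.
pose inv (p : set X * set X) := [/\ compact p.1, compact p.2,
  forall x y, p.1 x -> p.2 y -> ~ P (y, x), p.1 `<=` ~` B & p.2 `<=` ~` A].
pose grow n (p q : set X * set X) := [/\ p.1 `<=` q.1, p.2 `<=` q.2,
  A `&` K n `|` below p.1 `&` K n `<=` q.1° &
  B `&` K n `|` above p.2 `&` K n `<=` q.2°].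
(* The invariant is a premise inside the existential so that [choice] yields a total [next]; pairs
   violating it get a dummy value. *)
have step (np : nat * (set X * set X)) :
    exists q, inv np.2 -> inv q /\ grow np.1 np.2 q.
  case: np => n p /=.
  have [[c1 c2 sep d1 d2]|] := pselect (inv p); last by exists (set0, set0).
  pose A' := K n `&` A `|` K n `&` below p.1 `|` p.1.
  pose B' := K n `&` B `|` K n `&` above p.2 `|` p.2.
  have cA' : compact A'.
    by apply: compactU => //; apply: compactU;
      apply: compact_closedI => //; exact: closed_below.
  have cB' : compact B'.
    by apply: compactU => //; apply: compactU;
      apply: compact_closedI => //; exact: closed_above.
  have A'0 x : A' x -> A x \/ below p.1 x.
    by move=> [[[]|[]]|]; [left|right|move=> px; right; exists x].
  have B'0 x : B' x -> B x \/ above p.2 x.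
    by move=> [[[]|[]]|]; [left|right|move=> px; right; exists x].
  (* By transitivity, such a pair would lead from [B] or [p.2] to [A] or [p.1]; the four cases
     contradict [nAB], [d2], [d1] and [sep] in turn. *)
  have sep' x y : A' x -> B' y -> ~ P (y, x).
    move=> /A'0[Ax|[x' px' xx']] /B'0[By|[y' py' yy']] yx.
    - by apply: (nAB x) => //; exact: uB yx By.
    - by apply: (d2 _ py'); apply: dA Ax; exact: transP yx.
    - by apply: (d1 _ px'); apply: uB By; exact: transP yx xx'.
    - by apply: (sep _ _ px' py'); apply: transP yy' _; exact: transP yx xx'.
  have A'B : A' `<=` ~` B.
    move=> x /A'0[Ax|[y py xy]] Bx; first exact: (nAB x).
    by apply: (d1 _ py); exact: uB Bx.
  have B'A : B' `<=` ~` A.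
    move=> x /B'0[Bx|[y py xy]] Ax; first exact: (nAB x).
    by apply: (d2 _ py); exact: dA Ax.
  have oP : open (~` [set p | P (p.2, p.1)]) by rewrite openC.
  have [|U [V [oU oV AU BV UV]]] := compact_setX_tube cA' cB' oP.
    by move=> [x y] /= [A'x B'y]; exact: sep'.
  have [||A1 [cA1 AA1 A1U]] := @compact_nbhd _ A' (U `&` ~` B) lcX hX cA'.
  - by apply: openI => //; rewrite openC.
  - by rewrite subsetI.
  have [||B1 [cB1 BB1 B1V]] := @compact_nbhd _ B' (V `&` ~` A) lcX hX cB'.
  - by apply: openI => //; rewrite openC.
  - by rewrite subsetI.
  exists (A1, B1) => _; split; split=> //=.
  - move=> x y /A1U[Ux _] /B1V[Vy _]; exact: (UV (x, y)).
  - by move=> x /A1U[].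
  - by move=> x /B1V[].
  - by move=> x px; apply: interior_subset; apply: AA1; right.
  - by move=> x px; apply: interior_subset; apply: BB1; right.
  - by apply: subset_trans AA1 => x [[? ?]|[? ?]]; left; [left|right].
  - by apply: subset_trans BB1 => x [[? ?]|[? ?]]; left; [left|right].
have [next nextP] := choice step.
pose fix S n := if n is m.+1 then next (m, S m) else (set0, set0).
have invS n : inv (S n).
  elim: n => [|n IH] /=; first by split=> //=; exact: compact0.
  by have [] := nextP (n, S n) IH.
have growS n : grow n (S n) (S n.+1) by have [] := nextP (n, S n) (invS n).
have incS m n : (m <= n)%N -> (S m).1 `<=` (S n).1 /\ (S m).2 `<=` (S n).2.
  elim: n => [|n IH]; first by rewrite leqn0 => /eqP ->; split.
  rewrite leq_eqVlt => /predU1P[->|]; first by split.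
  move=> /IH[h1 h2].
  by have [g1 g2 _ _] := growS n; split; [exact: subset_trans g1|exact: subset_trans g2].
have Kex x : exists n, K n x by have : setT x by []; rewrite -KT => -[n]; exists n.
exists (\bigcup_n (S n).1°), (\bigcup_n (S n).2°); split.
- split; first by apply: bigcup_open => n _; exact: open_interior.
  move=> x y xy [n _ /interior_subset Sy].
  (* At [N] both the stage containing [y] and the compact set containing [x] have been reached, so
     the next stage absorbs [x]. *)
  have [k Kx] := Kex x; pose N := maxn n k; exists N.+1 => //.
  have [_ _ + _] := growS N; apply; right; split.
    by exists y => //; apply: (incS _ _ _).1 Sy; exact: leq_maxl.
  by apply: incK Kx; exact: leq_maxr.
- split; first by apply: bigcup_open => n _; exact: open_interior.
  move=> y x yx [n _ /interior_subset Sy].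
  have [k Kx] := Kex x; pose N := maxn n k; exists N.+1 => //.
  have [_ _ _] := growS N; apply; right; split.
    by exists y => //; apply: (incS _ _ _).2 Sy; exact: leq_maxl.
  by apply: incK Kx; exact: leq_maxr.
- move=> x Ax; have [k Kx] := Kex x; exists k.+1 => //.
  by have [_ _ + _] := growS k; apply; left.
- move=> x Bx; have [k Kx] := Kex x; exists k.+1 => //.
  by have [_ _ _] := growS k; apply; left.
- rewrite -subset0 => x [[m _ /interior_subset Sm] [n _ /interior_subset Sn]].
  have [_ _ sep _ _] := invS (maxn m n).
  apply: (sep x x) (reflP x).
    by apply: (incS _ _ _).1 Sm; exact: leq_maxl.
  by apply: (incS _ _ _).2 Sn; exact: leq_maxr.
Qed.

(** The complement of [W] is a closed upper set. Separating it from [D] gives [V], and the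
    complement of the open upper set around it serves as [E]. *)
Lemma lower_interpolation (D W : set X) : closed D -> lower_set P D ->
  open W -> lower_set P W -> D `<=` W ->
  exists V E, [/\ open V /\ lower_set P V, closed E /\ lower_set P E,
                  D `<=` V, V `<=` E & E `<=` W].
Proof.
move=> clD dD oW dW DW.
have [|||V [U [V' U' DV WU VU]]] :=
    @lower_upper_separation D (~` W) clD dD.
- by rewrite closedC.
- by move=> x y xy nWx Wy; apply: nWx; exact: dW Wy.
- by apply/disjoints_subset; rewrite setCK.
have [oU uU] := U'; exists V, (~` U); split=> //.
- split; first by rewrite closedC.
  by move=> x y xy nUy Ux; apply: nUy; exact: uU Ux.
- exact/disjoints_subset.
- by move=> x nUx; apply: contrapT => nWx; apply: nUx; exact: WU.
Qed.

End normally_preordered.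

(** * Urysohn functions monotone for a preorder *)

Section dyadic_urysohn.
Context {R : realType} {X : topologicalType} (P : set (X * X)).
Hypothesis interpolation : forall D W : set X, closed D -> lower_set P D ->
  open W -> lower_set P W -> D `<=` W ->
  exists V E, [/\ open V /\ lower_set P V, closed E /\ lower_set P E,
                  D `<=` V, V `<=` E & E `<=` W].

Let node (p : set X * set X) := [/\ open p.1, lower_set P p.1,
  closed p.2, lower_set P p.2 & p.1 `<=` p.2].

(* [T n k] is a pair of an open lower set contained in a closed lower set,
   placed at the dyadic [k / 2 ^ n]; the closed set at a dyadic is contained in
   the open set at any larger one. *)
Lemma ordered_urysohn_lower (D W : set X) : closed D -> lower_set P D ->
  open W -> lower_set P W -> D `<=` W ->
  exists L : X -> R, [/\ continuous L, forall x y, P (x, y) -> L x <= L y,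
    forall x, 0 <= L x <= 2, forall x, D x -> L x = 0 &
    forall x, ~ W x -> 1 <= L x].
Proof.
move=> clD dD oW dW DW.
have mid_ex (pq : (set X * set X) * (set X * set X)) : exists m,
    node pq.1 -> node pq.2 -> pq.1.2 `<=` pq.2.1 ->
    [/\ node m, pq.1.2 `<=` m.1 & m.2 `<=` pq.2.1].
  case: pq => p q /=.
  have [[_ _ clp dp _]|] := pselect (node p); last by exists (set0, set0).
  have [[oq dq _ _ _]|] := pselect (node q); last by exists (set0, set0).
  have [pq|] := pselect (p.2 `<=` q.1); last by exists (set0, set0).
  have [V [E [[oV dV] [clE dE] pV VE Eq]]] := interpolation clp dp oq dq pq.
  by exists (V, E).
have [mid midP] := choice mid_ex.
(* [D] is the closed set at 0 and [W] the open set at 1. The closed set at 1 is already the whole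
   space, as is everything from 2 on, hence values in [[0, 2]] that are at least 1 off [W]. *)
pose T0 k : set X * set X := match k with
  0 => (set0, D) | 1 => (W, setT) | _ => (setT, setT) end.
pose fix T n := if n is m.+1 then
  (fun k => if odd k then mid (T m k./2, T m k./2.+1) else T m k./2) else T0.
have T_double n k : T n.+1 k.*2 = T n k by rewrite /= odd_double doubleK.
have TP n k : node (T n k) /\ (T n k).2 `<=` (T n k.+1).1.
  elim: n k => [|n IH] k.
    split; last by case: k => [|[|k]].
    by case: k => [|[|k]] /=; split=> //=; (exact: open0 || exact: openT).
  have [h1 h2] := IH k./2; have [h3 h4] := IH k./2.+1.
  have [m1 m2 m3] := midP (T n k./2, T n k./2.+1) h1 h3 h2.
  by rewrite /= uphalf_half; case: (boolP (odd k)) => ok /=; split=> //;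
    rewrite ?add0n ?add1n.
have T_refine n m k : T (n + m)%N (k * 2 ^ m)%N = T n k.
  elim: m => [|m IH]; first by rewrite addn0 expn0 muln1.
  by rewrite addnS expnS mulnCA mul2n T_double.
have T_sub n k : (T n k).1 `<=` (T n k).2 by have [[]] := TP n k.
have T_mono n k l : (k < l)%N -> (T n k).2 `<=` (T n l).1.
  elim: l => // l IH; rewrite ltnS leq_eqVlt => /predU1P[->|/IH h].
    by have [] := TP n l.
  have [_ h'] := TP n l; apply: subset_trans h'.
  by apply: subset_trans h _; exact: T_sub.
pose dya n k : R := k%:R / 2 ^+ n.
have T_lt n k m l : dya n k < dya m l -> (T n k).2 `<=` (T m l).1.
  rewrite /dya ltr_pdivrMr ?exprn_gt0// mulrAC ltr_pdivlMr ?exprn_gt0//.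
  rewrite -!natrX -!natrM ltr_nat => kl.
  by rewrite -(T_refine n m k) -(T_refine m n l) addnC; exact: T_mono.
pose S x := [set r | exists n k, (T n k).1 x /\ r = dya n k].
have S2 x : S x 2 by exists 0%N, 2%N; rewrite /dya expr0 divr1.
have S_ge0 x : lbound (S x) 0.
  by move=> _ [n [k [_ ->]]]; rewrite divr_ge0// exprn_ge0.
have Sinf x : has_inf (S x) by split; [exists 2|exists 0].
pose L x := inf (S x).
have L_le n k x : (T n k).1 x -> L x <= dya n k.
  by move=> Tx; apply: ge_inf; [exists 0|exists n, k].
have le_L n k x : ~ (T n k).1 x -> dya n k <= L x.
  move=> nTx; apply: lb_le_inf; first by exists 2.
  move=> _ [m [l [Tx ->]]]; rewrite leNgt; apply/negP => /T_lt h.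
  by apply/nTx/h; exact: T_sub.
have L_ge0 x : 0 <= L x by apply: lb_le_inf => //; exists 2.
have dya_lt (e : R) : 0 < e -> exists n, dya n 1 < e.
  move=> e0; have [n _ /(_ n (leqnn _))] := near_infty_natSinv_expn_lt (PosNum e0).
  by exists n; rewrite /dya.
exists L; split.
- move=> x; apply/cvgrPdist_lt => e e0.
  have [_ [n [k [Tx ->]]] Lxe] := inf_adherent e0 (Sinf x).
  have up : \forall y \near x, L y < L x + e.
    have xT : nbhs x (T n k).1.
      by apply: open_nbhs_nbhs; split=> //; have [[]] := TP n k.
    apply: filterS xT => y /L_le h; exact: le_lt_trans Lxe.
  have down : \forall y \near x, L x - e < L y.
    have [xe|xe] := ltP (L x - e) 0.
      by apply: nearW => y; exact: lt_le_trans (L_ge0 y).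
    have [m me] := dya_lt (e / 2) (divr_gt0 e0 (ltr0Sn _ 1)).
    have m0 : (0 : R) < 2 ^+ m by rewrite exprn_gt0.
    (* [j] is the first index at level [m] whose dyadic exceeds [L x - e]. Since [2 ^- m < e / 2],
       the dyadic of [j.+1] is still below [L x], so [x] lies outside the closed set at [j]; off
       that set [L] is at least the dyadic of [j]. *)
    pose j := (Num.truncn ((L x - e) * 2 ^+ m)).+1.
    have xem : 0 <= (L x - e) * 2 ^+ m by rewrite mulr_ge0// ltW.
    have /andP[jle jgt] := truncn_itv xem.
    have j1 : L x - e < dya m j by rewrite /dya ltr_pdivlMr.
    have j2 : dya m j.+1 < L x.
      move: jle; rewrite -ler_pdivrMr// => jle.
      have -> : dya m j.+1 = j.-1%:R / 2 ^+ m + 2 * dya m 1.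
        by rewrite /dya mulrA -mulrDl mulr1 -natrD addn2.
      move: jle me; rewrite /j /=; lra.
    have nTx : ~ (T m j).2 x.
      move=> T2x; have : L x <= dya m j.+1.
        by apply: L_le; have [_] := TP m j; exact.
      by rewrite leNgt j2.
    have xT : nbhs x (~` (T m j).2).
      by apply: open_nbhs_nbhs; split=> //; rewrite openC; have [[]] := TP m j.
    apply: filterS xT => y nTy; apply: (lt_le_trans j1); apply: le_L.
    by move=> /T_sub.
  near=> y; rewrite ltr_norml.
  have : L y < L x + e by near: y.
  have : L x - e < L y by near: y.
  by move=> h1 h2; apply/andP; split; lra.
- move=> x y xy; apply: lb_le_inf; first by exists 2.
  move=> _ [n [k [Ty ->]]]; apply: L_le.
  by have [[_ dT _ _ _] _] := TP n k; exact: dT Ty.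
- by move=> x; rewrite L_ge0/=; apply: ge_inf; [exists 0|].
- move=> x Dx; apply/eqP; rewrite eq_le L_ge0 andbT leNgt; apply/negP => /dya_lt[n].
  apply/negP; rewrite -leNgt; apply: L_le.
  (* The closed set at 0 remains [D] at every level, so [D] lies in the open set at [2 ^- n] for
     every [n]. *)
  have [_] := TP n 0%N; apply.
  suff -> : T n 0%N = T0 0%N by [].
  by elim: n => //= n ->.
- move=> x nWx; have := @le_L 0%N 1%N x nWx.
  by rewrite /dya expr0 divr1.
Unshelve. all: by end_near. Qed.

End dyadic_urysohn.

(** * Closed subalgebras and the Stone-Weierstrass theorem *)

Lemma bounded_funE (R : realType) (X : Type) (u : X -> R) :
  bounded_fun u <-> exists M, forall x, `|u x| <= M.
Proof.
split=> [[M [_ h]]|[M h]].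
  by exists (M + 1) => x; apply: (h (M + 1)) => //; rewrite ltrDl.
exists M; split; first exact: num_real.
by move=> N /ltW MN x _ /=; exact: le_trans (h x) MN.
Qed.

Lemma closed_uniformP (R : realType) (X : topologicalType) (A : set (X -> R)) :
  @closed {uniform X -> R} A <->
  (forall u, (forall e, 0 < e -> exists2 a, A a & forall x, `|u x - a x| < e) ->
     A u).
Proof.
split=> [clA u h|h u].
  apply: (clA u) => B /uniform_nbhs[E [entE EB]].
  move: entE; rewrite -entourage_ballE => -[e /= e0 eE].
  have [a Aa ua] := h e e0; exists a; split=> //; apply: EB => y _.
  by apply: eE => /=; exact: ua.
move=> clu; apply: h => e e0.
have [|a [Aa ua]] := clu [set a | forall x, `|u x - a x| < e].
  apply/uniform_nbhs; exists [set xy | ball xy.1 e xy.2]; split.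
    exact: (entourage_ball _ (PosNum e0)).
  by move=> a ua y; exact: ua.
by exists a.
Qed.

Section bounded_continuous_functions.
Context {R : realType} {X : topologicalType}.
Implicit Types u v : X -> R.

Lemma bounded_continuous_closed :
  @closed_subalgebra R X (@bounded_continuous R X).
Proof.
split=> //.
- move=> c; split; first by move=> x; exact: cvg_cst.
  by apply/bounded_funE; exists `|c| => x.
- move=> u v [cu /bounded_funE[M uM]] [cv /bounded_funE[N vN]]; split.
    by move=> x; apply: cvgD; [exact: cu|exact: cv].
  apply/bounded_funE; exists (M + N) => x /=.
  by apply: (le_trans (ler_normD _ _)); exact: lerD.
- move=> u v [cu /bounded_funE[M uM]] [cv /bounded_funE[N vN]]; split.
    by move=> x; apply: cvgM; [exact: cu|exact: cv].
  apply/bounded_funE; exists (M * N) => x /=.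
  by rewrite normrM; exact: ler_pM.
- apply/closed_uniformP => u h; split.
    move=> x; apply/cvgrPdist_lt => e e0.
    have e3 : 0 < e / 3 by rewrite divr_gt0.
    have [a [ca _] ua] := h _ e3.
    have /cvgrPdist_lt/(_ _ e3) := ca x.
    apply: filterS => y axy; have := ua x; have := ua y.
    rewrite !ltr_norml in axy * => /andP[? ?] /andP[? ?].
    by case/andP: axy => ? ?; apply/andP; split; lra.
  have [a [_ /bounded_funE[M aM]] ua] := h 1 ltr01.
  apply/bounded_funE; exists (1 + M) => x.
  rewrite -(subrK (a x) (u x)); apply: (le_trans (ler_normD _ _)).
  by apply: lerD => //; exact: ltW.
Qed.

(** Boundedness of [S] guarantees a closed subalgebra containing [S]; otherwise the intersection
    would run over an empty family and be everything. *)
Lemma generated_subalgebra_closed (S : set (X -> R)) :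
  S `<=` @bounded_continuous R X ->
  closed_subalgebra (generated_subalgebra S).
Proof.
move=> SB; have genB : generated_subalgebra S `<=` @bounded_continuous R X.
  by apply: smallest_sub => //; exact: bounded_continuous_closed.
split=> //.
- by move=> c A [[]].
- by move=> u v hu hv A [cA SA]; have [_ _ + _ _] := cA; apply;
    [exact: hu|exact: hv].
- by move=> u v hu hv A [cA SA]; have [_ _ _ + _] := cA; apply;
    [exact: hu|exact: hv].
- apply/closed_uniformP => u h A [cA SA]; have [_ _ _ _ /closed_uniformP] := cA.
  by apply=> e /h[a ha ua]; exists a => //; exact: ha.
Qed.

Lemma sub_generated_subalgebra (S : set (X -> R)) : S `<=` generated_subalgebra S.
Proof. exact: sub_gen_smallest. Qed.

Lemma compact_continuous_bounded u : compact [set: X] -> continuous u ->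
  bounded_fun u.
Proof.
move=> cX cu; have : compact (u @` setT).
  by apply: continuous_compact => //; exact: continuous_subspaceT.
case/compact_bounded => M [_ h]; apply/bounded_funE; exists (M + 1) => x.
by apply: (h (M + 1)); [rewrite ltrDl|exists x].
Qed.

End bounded_continuous_functions.

Section abs_approx.
Context {R : realType}.

(* A fixed point [p >= 0] of the iteration satisfies [p ^+ 2 = t ^+ 2]. *)
Fixpoint abs_approx (n : nat) (t : R) : R :=
  if n is m.+1 then abs_approx m t + (t ^+ 2 - abs_approx m t ^+ 2) / 2 else 0.

Lemma abs_approx_bound n (t : R) : `|t| <= 1 ->
  0 <= abs_approx n t /\
  0 <= `|t| - abs_approx n t <= `|t| * (1 - `|t| / 2) ^+ n.
Proof.
move=> t1; have t0 := normr_ge0 t; set s := `|t| in t1 t0 *.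
elim: n => [|n [IH0 /andP[IH1 IH2]]] /=; first by rewrite expr0 mulr1 subr0; split=> //; apply/andP.
have ts : t ^+ 2 = s ^+ 2 by rewrite /s real_normK// num_real.
set p := abs_approx n t in IH0 IH1 IH2 *; rewrite ts.
(* One iteration multiplies the error by [1 - (s + p) / 2], which lies between 0 and [1 - s / 2]
   because [0 <= p <= s <= 1]. *)
have -> : s - (p + (s ^+ 2 - p ^+ 2) / 2) = (s - p) * (1 - (s + p) / 2) by field.
split; last (apply/andP; split).
- have sp : 0 <= s + p by exact: addr_ge0.
  by have := mulr_ge0 IH1 sp; nra.
- by apply: mulr_ge0 => //; lra.
- rewrite exprSr mulrA; apply: ler_pM => //; lra.
Qed.

Lemma abs_approx_lt (e : R) : 0 < e ->
  exists n, forall t, `|t| <= 1 -> `| `|t| - abs_approx n t| < e.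
Proof.
move=> e0; pose n := Num.truncn (2 / e); exists n => t t1.
have [_ /andP[h1 h2]] := abs_approx_bound n t1.
rewrite ger0_norm//; apply: (le_lt_trans h2).
have t0 := normr_ge0 t; move: t1 t0; set s := `|t| => t1 t0.
(* This yields [s * (1 - s / 2) ^+ n <= 2 / (n + 1)], a bound that does not depend on [s]; hence the
   choice of [n] as the truncation of [2 / e]. *)
have bernoulli m : (1 - s / 2) ^+ m * (1 + m%:R * (s / 2)) <= 1.
  elim: m => [|m IH]; first by rewrite expr0 mul0r addr0 mulr1.
  apply: le_trans IH; rewrite exprSr -mulrA; apply: ler_wpM2l.
    by apply: exprn_ge0; lra.
  rewrite -natr1; have : 0 <= (m%:R : R) by [].
  nra.
have en : 2 / e < n.+1%:R.
  by have /andP[] := @truncn_itv _ (2 / e) (divr_ge0 (ler0n _ 2) (ltW e0)).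
have q0 : 0 <= (1 - s / 2) ^+ n by apply: exprn_ge0; lra.
have := bernoulli n; set q := (_ ^+ n) in q0 *.
rewrite ltr_pdivrMr// -natr1 in en => h.
have n0 : 0 <= (n%:R : R) by [].
rewrite -(@ltr_pM2l _ (n%:R + 1)); last by lra.
apply: (@le_lt_trans _ _ 2); last by lra.
apply: (@le_trans _ _ (2 * (q * (1 + n%:R * (s / 2))))); last by lra.
have : 0 <= q * (1 - s / 2) by apply: mulr_ge0 => //; lra.
lra.
Qed.

End abs_approx.

Section stone_weierstrass.
Context {R : realType} {X : topologicalType} (A : set (X -> R)).
Hypothesis cX : compact [set: X].
Hypothesis hA : closed_subalgebra A.
Implicit Types u v : X -> R.

Let A_cst c : A (cst c). Proof. by have [] := hA. Qed.
Let AD u v : A u -> A v -> A (u \+ v). Proof. by have [_ _ + _ _] := hA; apply. Qed.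
Let AM u v : A u -> A v -> A (u \* v). Proof. by have [_ _ _ + _] := hA; apply. Qed.

Let A_lim u : (forall e, 0 < e -> exists2 a, A a & forall x, `|u x - a x| < e) -> A u.
Proof. by have [_ _ _ _ /closed_uniformP] := hA; apply. Qed.

Let AZ c u : A u -> A (fun x => c * u x).
Proof. by move=> Au; exact: (AM (A_cst c) Au). Qed.

Let AB u v : A u -> A v -> A (fun x => u x - v x).
Proof.
move=> Au Av; rewrite (_ : (fun _ => _) = u \+ (fun x => -1 * v x)).
  by apply: AD => //; exact: AZ.
by apply/funext => x /=; rewrite mulN1r.
Qed.

Lemma subalgebra_norm u : A u -> A (fun x => `|u x|).
Proof.
move=> Au; have [/(_ _ Au)[_ /bounded_funE[M uM]] _ _ _ _] := hA.
pose N := `|M| + 1; have N0 : 0 < N by rewrite ltr_wpDl.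
have uN x : `|u x / N| <= 1.
  rewrite normrM normfV (gtr0_norm N0) ler_pdivrMr// mul1r.
  apply: (le_trans (uM x)); apply: (le_trans (ler_norm M)).
  by rewrite lerDl.
apply: A_lim => e e0.
have [n nP] := abs_approx_lt (divr_gt0 e0 N0).
exists (fun x => N * abs_approx n (u x / N)).
  apply: AZ; elim: n {nP} => [|n IH] /=; first exact: A_cst.
  have Aw : A (fun x => u x / N).
    rewrite (_ : (fun _ => _) = fun x => N^-1 * u x); first exact: AZ.
    by apply/funext => x; rewrite mulrC.
  rewrite (_ : (fun _ => _) = (fun x => abs_approx n (u x / N)) \+
    (fun x => 2^-1 * ((u x / N) * (u x / N) -
             abs_approx n (u x / N) * abs_approx n (u x / N)))).
    by apply: AD => //; apply: AZ; exact: (AB (AM Aw Aw) (AM IH IH)).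
  by apply/funext => x /=; rewrite !expr2 [_ / 2]mulrC.
move=> x; have h := nP _ (uN x).
have -> : `|u x| - N * abs_approx n (u x / N) =
    N * (`|u x / N| - abs_approx n (u x / N)).
  by rewrite mulrBr [`|u x / N|]normrM normfV (gtr0_norm N0) mulrCA divff ?mulr1 ?gt_eqF.
by rewrite normrM (gtr0_norm N0) mulrC -ltr_pdivlMr.
Qed.

Lemma subalgebra_max u v : A u -> A v -> A (fun x => Num.max (u x) (v x)).
Proof.
move=> Au Av; rewrite (_ : (fun _ => _) =
    fun x => 2^-1 * ((u x + v x) + `|u x - v x|)).
  apply: AZ; apply: (AD (AD Au Av)).
  by apply: (subalgebra_norm (u := fun x => u x - v x)); exact: AB.
by apply/funext => x; rewrite maxr_absE mulrC.
Qed.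

Lemma subalgebra_min u v : A u -> A v -> A (fun x => Num.min (u x) (v x)).
Proof.
move=> Au Av; rewrite (_ : (fun _ => _) =
    fun x => 2^-1 * ((u x + v x) - `|u x - v x|)).
  apply: AZ; apply: (AB (AD Au Av)).
  by apply: (subalgebra_norm (u := fun x => u x - v x)); exact: AB.
by apply/funext => x; rewrite minr_absE mulrC.
Qed.

Hypothesis sepA : forall x y, x <> y -> exists2 u, A u & u x <> u y.

Let interpolate v x y : exists u, [/\ A u, u x = v x & u y = v y].
Proof.
have [->|xy] := pselect (x = y); first by exists (cst (v y)).
have [u Au uxy] := sepA xy.
exists (fun z => v x + (v y - v x) / (u y - u x) * (u z - u x)); split.
- apply: (@AD (cst (v x)) (fun z => _ * (u z - u x))) => //; apply: AZ.
  exact: (AB Au (A_cst _)).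
- by rewrite subrr mulr0 addr0.
- by rewrite divfK ?subrKC// subr_eq0; apply/eqP => h; apply: uxy.
Qed.

Let near_lt u v x : continuous u -> continuous v -> u x < v x ->
  \forall y \near x, u y < v y.
Proof.
move=> cu cv uv.
have : v y - u y @[y --> x] --> v x - u x by apply: cvgB; [exact: cv|exact: cu].
move/cvgr_gt => /(_ 0); rewrite subr_gt0 => /(_ uv).
by apply: filterS => y /=; rewrite subr_gt0.
Qed.

Let A_continuous u : A u -> continuous u.
Proof. by have [h _ _ _ _] := hA; move=> /h[]. Qed.

(** Lattice argument: a finite maximum of two-point interpolants exceeds [v - e] and agrees with [v]
    at a given point; a finite minimum of such functions is also below [v + e]. The finite extrema
    come from the near-covering property, with filters along which the functions increase, then
    decrease. *)
Theorem stone_weierstrass v : continuous v -> A v.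
Proof.
move=> cv; have /compact_near_coveringP cov := cX.
apply: A_lim => e e0.
have cvD c : continuous (fun x => v x + c).
  by move=> x; apply: cvgD; [exact: cv|exact: cvg_cst].
have above x : exists u, [/\ A u, u x = v x & forall z, v z - e < u z].
  pose F := filter_from [set u | A u /\ u x = v x]
    (fun u => [set w | forall z, u z <= w z]).
  have FF : Filter F.
    apply: filter_from_filter; first by exists (cst (v x)).
    move=> u w [Au ux] [Aw wx]; exists (fun z => Num.max (u z) (w z)).
      by split; [exact: subalgebra_max|rewrite ux wx maxxx].
    by move=> h hmax; split=> z; apply: le_trans (hmax z); rewrite le_max lexx ?orbT.
  have [y _|u [Au ux] uP] := cov _ F (fun w z => v z - e < w z) FF.
    have [u [Au ux uy]] := interpolate v x y.
    have ev : v y - e < u y by rewrite uy gtrBl.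
    exists ([set z | v z - e < u z], [set w | forall z, u z <= w z]) => /=.
      by split; [exact: near_lt (cvD _) (A_continuous Au) ev|exists u].
    by move=> [z w] /= [h1 /(_ z)]; exact: lt_le_trans.
  by exists u; split=> // z; apply: (uP u) => //= t; exact: lexx.
pose F := filter_from [set u | A u /\ forall z, v z - e < u z]
    (fun u => [set w | forall z, w z <= u z]).
have FF : Filter F.
  apply: filter_from_filter.
    (* The base of the filter must be nonempty; on an empty [X] no function comes from [above], and
       a constant does. *)
    have [[x _]|nX] := pselect (exists x : X, True).
      by have [u [Au _ uv]] := above x; exists u.
    by exists (cst 0); split=> // z; exfalso; apply: nX; exists z.
  move=> u w [Au ux] [Aw wx]; exists (fun z => Num.min (u z) (w z)).
    by split; [exact: subalgebra_min|move=> z; rewrite lt_min ux wx].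
  by move=> h hmax; split=> z; apply: (le_trans (hmax z)); rewrite ge_min lexx ?orbT.
have [y _|u [Au uv] uP] := cov _ F (fun w z => w z < v z + e) FF.
  have [u [Au uy uv]] := above y.
  have ev : u y < v y + e by rewrite uy ltrDl.
  exists ([set z | u z < v z + e], [set w | forall z, w z <= u z]) => /=.
    by split; [exact: near_lt (A_continuous Au) (cvD _) ev|exists u].
  by move=> [z w] /= [h1 /(_ z)] h2; exact: le_lt_trans h1.
exists u => // x; have h1 := uv x.
have h2 : u x < v x + e by apply: (uP u) => //= t; exact: lexx.
by rewrite ltr_norml; apply/andP; split; lra.
Qed.

End stone_weierstrass.

(** * Compactifications from function algebras *)

Section bump.
Context {R : realType} {X : topologicalType}.

Lemma compact_support_bump (x : X) (O : set X) : locally_compact [set: X] ->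
  hausdorff_space X -> open O -> O x ->
  exists2 u : X -> R, compact_support u & u x = 1 /\ forall y, ~ O y -> u y = 0.
Proof.
move=> lcX hX oO Ox.
have [|K [cK xK KO]] := compact_nbhd lcX hX (@compact_set1 _ x) oO.
  by move=> _ ->.
have clK : closed (~` K°) by rewrite closedC; exact: open_interior.
have nK : ~ (~` K°) x by move=> h; apply/h/xK.
have /(@uniform_separatorP _ R)[v [cv _ v0 v1]] :=
  locally_compact_completely_regular (R := R) lcX hX clK nK.
exists (fun y => 1 - v y).
  split; first by move=> y; apply: cvgB; [exact: cvg_cst|exact: cv].
  apply: (subclosed_compact _ cK); first exact: closed_closure.
  have /closure_id -> := compact_closed hX cK.
  apply: closureS => y /= vy; apply: contrapT => nKy; move/eqP: vy; apply.
  rewrite [v y]v1 ?subrr//; exists y => // /interior_subset; exact: nKy.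
split=> [|y nOy]; first by rewrite [v x]v0 ?subr0//; exists x.
rewrite [v y]v1 ?subrr//; exists y => // /interior_subset/KO; exact: nOy.
Qed.

Lemma compact_support_bounded : @compact_support R X `<=` @bounded_continuous R X.
Proof.
move=> u [cu cs]; split=> //.
have : compact (u @` closure [set x | u x != 0]).
  by apply: continuous_compact => //; exact: continuous_subspaceT.
case/compact_bounded => M [_ h]; apply/bounded_funE; exists (`|M| + 1) => x.
have [->|ux] := eqVneq (u x) 0; first by rewrite normr0 addr_ge0.
apply: (h (`|M| + 1)); first by rewrite (le_lt_trans (ler_norm M))// ltrDl.
by exists x => //; exact: subset_closure.
Qed.

Lemma compact_separation (x y : X) : compact [set: X] -> hausdorff_space X ->
  x <> y -> exists u : X -> R, [/\ continuous u, u x = 1 & u y = 0].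
Proof.
move=> cX hX xy; have lcX : locally_compact [set: X].
  by move=> z _; exists setT => //; exact: filterT.
have [|//|u [cu _] [ux uy]] := @compact_support_bump x (~` [set y]) lcX hX.
  by rewrite openC; apply: (compact_closed hX); exact: compact_set1.
by exists u; split=> //; apply: uy; apply.
Qed.

End bump.

Lemma bounded_continuous_comp (R : realType) (X Y : topologicalType)
    (g : X -> Y) (u : Y -> R) : continuous g ->
  bounded_continuous u -> bounded_continuous (u \o g).
Proof.
move=> cg [cu /bounded_funE[M uM]]; split.
  by move=> x; apply: continuous_comp; [exact: cg|exact: cu].
by apply/bounded_funE; exists M => x; exact: uM.
Qed.

(** Used to move an algebra on [X] to a compactification, and, with minimality, to show that a
    generated algebra is stable under composition. *)
Lemma comp_subalgebra (R : realType) (X Y : topologicalType) (g : X -> Y)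
    (A : set (X -> R)) : closed_subalgebra A ->
  closed_subalgebra [set u : Y -> R | bounded_continuous u /\ A (u \o g)].
Proof.
case=> _ Ac AD AM /closed_uniformP clA.
have [_ Bc BD BM /closed_uniformP clB] := @bounded_continuous_closed R Y.
split=> //.
- by move=> u [].
- by move=> c; split; [exact: Bc|exact: (Ac c)].
- by move=> u v [bu Au] [bv Av]; split; [exact: BD|exact: (AD _ _ Au Av)].
- by move=> u v [bu Au] [bv Av]; split; [exact: BM|exact: (AM _ _ Au Av)].
- apply/closed_uniformP => u h; split.
    by apply: clB => e /h[a [ba _] ua]; exists a.
  by apply: clA => e /h[a [_ Aa] ua]; exists (a \o g) => // x; exact: ua.
Qed.

Section compactification.
Context {R : realType} {X : topologicalType} (A : set (X -> R)).
Hypothesis lcX : locally_compact [set: X].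
Hypothesis hX : hausdorff_space X.
Hypothesis hA : closed_subalgebra A.
Hypothesis csA : @compact_support R X `<=` A.

(* [Xh] is the closure of the image of [X] in the product of copies of [R]
   indexed by [A]. *)
Let PT := prod_topology (fun _ : A => R).
Let j (x : X) : PT := fun u => val u x.
Let K := closure (range j).
Let Xh : topologicalType := K.

Let j_continuous : continuous j.
Proof.
move=> x; apply/cvg_sup => u; move: x.
apply/(@continuousP _ (initial_topology (@^~ u))) => _ [B oB <-].
have [/(_ _ (set_mem (valP u)))[cu _] _ _ _ _] := hA.
by rewrite (_ : _ @^-1` _ = val u @^-1` B)//; apply: open_comp => // y _; exact: cu.
Qed.

Let compact_K : compact K.
Proof.
have bnd (u : A) : exists M : R, forall x, `|val u x| <= M.
  by have [/(_ _ (set_mem (valP u)))[_ /bounded_funE bu] _ _ _ _] := hA.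
have [M MP] := choice bnd.
have cB := @tychonoff _ (fun _ : A => R) (fun u => [set` `[- M u, M u]])
  (fun u => @segment_compact R _ _).
apply: (subclosed_compact _ cB); first exact: closed_closure.
have hP : hausdorff_space PT.
  by apply: hausdorff_product => _; exact: Rhausdorff.
have /closure_id clB := compact_closed hP cB.
rewrite /K [X in _ `<=` X]clB; apply: closureS => _ [x _ <-] u /=.
by rewrite in_itv/= -ler_norml; exact: MP.
Qed.

Let compact_Xh : compact [set: Xh].
Proof.
move=> F PF _.
have [|p [Kp cp]] := compact_K (F := (set_val : K -> PT) @ F).
  by rewrite /= /nbhs /=; apply: filterS filterT => p _ /=; exact: set_valP.
exists (exist _ p (mem_set Kp)); split=> // B C FB [_ [[C' oC' <-] C'p C'C]].
have [||q [[b Bb <-] C'b]] := cp (set_val @` B) C'.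
- by apply: (@filterS _ F _ B) => // b Bb; exists b.
- by apply: open_nbhs_nbhs.
- by exists b; split=> //; apply: C'C.
Qed.

Let val_continuous : continuous (set_val : Xh -> PT).
Proof. exact: initial_continuous. Qed.

Let coord_continuous (u : A) : continuous (fun p : Xh => (set_val p : PT) u).
Proof.
move=> p; apply: (@continuous_comp Xh PT R set_val (fun g : PT => g u)).
  exact: val_continuous.
exact: proj_continuous.
Qed.

Let hausdorff_Xh : hausdorff_space Xh.
Proof.
move=> p q pq; apply: val_inj.
have hP : hausdorff_space PT.
  by apply: hausdorff_product => _; exact: Rhausdorff.
apply: hP => B C /val_continuous Bp /val_continuous Cq.
by have [r [Br Cr]] := pq _ _ Bp Cq; exists (set_val r).
Qed.

Let i (x : X) : Xh := exist _ (j x) (mem_set (@subset_closure _ (range j) _ (imageT j x))).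

Let i_continuous : continuous i.
Proof. exact: (@continuous_comp_initial _ _ _ set_val). Qed.

Let i_embedding (U : set X) :
  open U <-> exists2 B : set Xh, open B & i @^-1` B = U.
Proof.
split=> [oU|[B oB <-]]; last by apply: open_comp => // x _; exact: i_continuous.
(* The largest open set with trace inside [U] is taken; the nonvanishing set of a coordinate given
   by a bump function shows that it reaches every point of [U]. *)
exists (\bigcup_(B in [set B : set Xh | open B /\ i @^-1` B `<=` U]) B).
  by apply: bigcup_open => B [].
apply/seteqP; split=> x; first by case=> B [_]; apply.
move=> Ux; have [u cu [ux uO]] := compact_support_bump (R := R) lcX hX oU Ux.
pose u' : A := exist _ u (mem_set (csA cu)).
exists [set p : Xh | (set_val p : PT) u' != 0]; last first.
  by change (is_true (u x != 0)); rewrite ux oner_neq0.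
split.
  apply: (@open_comp _ _ (fun p : Xh => (set_val p : PT) u') [set t | t != 0]).
    by move=> p _; exact: coord_continuous.
  exact: open_neq.
move=> y uy; have /eqP {}uy : is_true (u y != 0) by [].
 apply: contrapT => /uO; exact: uy.
Qed.

Lemma compactification_exists :
  exists (Xh : topologicalType) (i : X -> Xh), associated_compactification A i.
Proof.
exists Xh, i; split.
  split=> //.
  - move=> x y ixy; apply: contrapT => xy.
    have [|//|u cu [ux uy]] := @compact_support_bump R X x (~` [set y]) lcX hX.
      by rewrite openC; apply: (compact_closed hX); exact: compact_set1.
    have : u x = u y.
      have := congr1 (fun p : Xh => (set_val p : PT) (exist _ u (mem_set (csA cu)))) ixy.
      by [].
    rewrite ux uy; last by apply.
    by move/eqP; rewrite oner_eq0.
  - move=> O [p Op] [W oW WO].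
    have nO : nbhs (set_val p : PT) W.
      by apply: open_nbhs_nbhs; split=> //; move: Op; rewrite -WO.
    have [_ [[x _ <-] Wx]] := set_mem (valP p) W nO.
    by exists (i x); split; [rewrite -WO|exists x].
apply/seteqP; split=> [u [bu [uh cuh uhu]]|u Au].
  (* The functions on [Xh] whose restriction to [X] is in [A] form a closed subalgebra containing
     the coordinates, which separate points; by Stone-Weierstrass it contains every continuous
     function. *)
  have sep (p q : Xh) : p <> q -> exists2 v, [set v : Xh -> R |
      bounded_continuous v /\ A (v \o i)] v & v p <> v q.
    move=> pq; apply: contrapT => h; apply/pq/val_inj/funext => u'.
    apply: contrapT => pqu; apply: h.
    exists (fun p : Xh => (set_val p : PT) u') => //; split.
      split; first exact: coord_continuous.
      exact: compact_continuous_bounded.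
    by rewrite (_ : _ \o _ = val u')//; exact: set_mem (valP u').
  have [_] := stone_weierstrass compact_Xh (comp_subalgebra i hA) sep cuh.
  by rewrite uhu.
have [/(_ _ Au) bu _ _ _ _] := hA; split=> //.
by exists (fun p : Xh => (set_val p : PT) (exist _ u (mem_set Au))).
Qed.

End compactification.

(** * The smallest closed transitive relation containing a map *)

Lemma generated_subalgebra_comp (R : realType) (X : topologicalType)
    (S : set (X -> R)) (g : X -> X) : S `<=` @bounded_continuous R X ->
  (forall u, S u -> generated_subalgebra S (u \o g)) ->
  forall u, generated_subalgebra S u -> generated_subalgebra S (u \o g).
Proof.
move=> SB Sg u Su.
have := Su [set u | bounded_continuous u /\ generated_subalgebra S (u \o g)].
case=> //; split; first exact: comp_subalgebra (generated_subalgebra_closed SB).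
by move=> v Sv; split; [exact: SB|exact: Sg].
Qed.

Section GG_theory.
Context {X : topologicalType}.
Implicit Types r : set (X * X).

Lemma closed_GG r : closed (GG r).
Proof. by apply: closed_bigI => s [[]]. Qed.

Lemma GG_trans r : rel_transitive (GG r).
Proof.
move=> x y z xy yz s sP; have [[_ tr] _] := sP.
by apply: (tr x y z); [exact: xy|exact: yz].
Qed.

Lemma sub_GG r : r `<=` GG r.
Proof. exact: sub_gen_smallest. Qed.

Lemma GG_sub r (s : set (X * X)) : closed s -> rel_transitive s -> r `<=` s -> GG r `<=` s.
Proof. by move=> cs ts rs; exact: smallest_sub. Qed.

Variable g : X -> X.
Hypothesis cg : continuous g.
Hypothesis hX : hausdorff_space X.

Lemma GG_graph x : GG (graph_of g) (x, g x).
Proof. exact: sub_GG. Qed.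

Lemma closed_graph_of : closed (graph_of g).
Proof.
rewrite (_ : graph_of g = (fun p => (g p.1, p.2)) @^-1` @diagonal X).
  apply: preimage_closed; last exact: closed_diagonal.
  move=> p _; apply: cvg_pair; last exact: cvg_snd.
  by apply: continuous_comp; [exact: cvg_fst|exact: cg].
by apply/seteqP; split=> p /diagonalP.
Qed.

(** The pairs satisfying the conclusion form a closed transitive relation, by continuity of [g]. *)
Lemma GG_first_step x y : GG (graph_of g) (x, y) ->
  g x = y \/ GG (graph_of g) (g x, y).
Proof.
apply: (@GG_sub _ [set p | g p.1 = p.2 \/ GG (graph_of g) (g p.1, p.2)] _ _ _ (x, y)).
- apply: closedU; first exact: closed_graph_of.
  apply: (@preimage_closed _ _ (fun p => (g p.1, p.2))); last exact: closed_GG.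
  move=> p _; apply: cvg_pair; last exact: cvg_snd.
  by apply: continuous_comp; [exact: cvg_fst|exact: cg].
- move=> a b c /= ab bc.
  have {}bc : GG (graph_of g) (b, c).
    by case: bc => [<-|]; [exact: GG_graph|apply: GG_trans; exact: GG_graph].
  by right; case: ab => [->//|ab]; exact: GG_trans bc.
- by move=> [a b] ab; left.
Qed.

(** Unlike for the first step, a direct image under [g] is taken in the second coordinate;
    compactness makes it closed. *)
Lemma GG_last_step x y : compact [set: X] -> GG (graph_of g) (x, y) ->
  exists2 z, g z = y & x = z \/ GG (graph_of g) (x, z).
Proof.
move=> cX.
pose Q := @diagonal X `|` GG (graph_of g).
have clQ : closed Q by apply: closedU; [exact: closed_diagonal|exact: closed_GG].
pose s := (fun p : X * X => (p.1, g p.2)) @` Q.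
have cls : closed s.
  have hXX : hausdorff_space (X * X)%type.
    move=> [a b] [c d] ab_cd; congr pair; apply: hX => U V Ua Vc.
      have [] := ab_cd (fst @^-1` U) (fst @^-1` V).
      - exact: (@cvg_fst _ _ _ _ _ U).
      - exact: (@cvg_fst _ _ _ _ _ V).
      - by move=> p []; exists p.1.
    have [] := ab_cd (snd @^-1` U) (snd @^-1` V).
    - exact: (@cvg_snd _ _ _ _ _ U).
    - exact: (@cvg_snd _ _ _ _ _ V).
    - by move=> p []; exists p.2.
  apply: (compact_closed hXX); apply: continuous_compact.
    apply: continuous_subspaceT => p.
    apply: cvg_pair; first exact: cvg_fst.
    by apply: continuous_comp; [exact: cvg_snd|exact: cg].
  apply: (subclosed_compact clQ) (@subsetT _ _).
  by rewrite -setXTT; exact: compact_setX.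
have sG : s `<=` GG (graph_of g).
  move=> _ [[a b] /= [/diagonalP <-|ab] <-]; first exact: GG_graph.
  by apply: GG_trans ab _; exact: GG_graph.
move=> /(GG_sub cls) -[].
- move=> a b c /sG ab [[b' c'] /= bc [bE cE]]; subst b' c; exists (a, c') => //=.
  right; case: bc => [/diagonalP/= <-//|]; exact: GG_trans.
- by move=> [a b] ab; exists (a, a); [left; apply/diagonalP|rewrite /= ab].
- move=> [a b] /= ab [xE yE]; subst x y; exists b => //.
Qed.

End GG_theory.

(** * Extension of functions and maps to a compactification *)

Section proper_compactification_theory.
Context {X Xh : topologicalType} (i : X -> Xh).
Hypothesis pci : proper_compactification i.
Hypothesis lcX : locally_compact [set: X].

Let cXh : compact [set: Xh]. Proof. by have [[]] := pci. Qed.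
Let hXh : hausdorff_space Xh. Proof. by have [[]] := pci. Qed.
Let i_emb (A : set X) : open A <-> exists2 B : set Xh, open B & i @^-1` B = A.
Proof. by have [_ _ h _] := pci. Qed.
Let i_dense : dense (range i). Proof. by have [] := pci. Qed.

Lemma compactification_continuous : continuous i.
Proof. by apply/continuousP => B oB; apply/i_emb; exists B. Qed.
Let ci := compactification_continuous.

Lemma closed_dense_range (C : set Xh) : closed C -> (forall x, C (i x)) ->
  forall p, C p.
Proof.
move=> clC Ci p; apply: contrapT => nCp.
have [|q [nCq [x _ xq]]] := @i_dense (~` C) (ex_intro _ p nCp).
  by rewrite openC.
by apply: nCq; rewrite -xq.
Qed.

Lemma compact_image (K : set X) : compact K -> compact (i @` K).
Proof.
by move=> cK; apply: continuous_compact => //; exact: continuous_subspaceT.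
Qed.

Lemma compact_preimage (K : set Xh) : K `<=` range i -> compact K ->
  compact (i @^-1` K).
Proof.
move=> Ki cK F PF FK.
have [|q [Kq cq]] := cK (i @ F) _; first exact: FK.
have [x _ xq] := Ki q Kq; exists x; split; first by rewrite /= xq.
move=> A B FA xB; move: xB; rewrite nbhsE => -[B' [oB' B'x] B'B].
have [C oC CB'] := (i_emb B').1 oB'.
have [||y [[a Aa <-] Ca]] := cq (i @` A) C.
- by apply: (@filterS _ F _ A) => // a Aa; exists a.
- by apply: open_nbhs_nbhs; split=> //; rewrite -xq; move: B'x; rewrite -CB'.
- by exists a; split=> //; apply: B'B; rewrite -CB'.
Qed.

Lemma open_range : open (range i).
Proof.
rewrite openE => _ [x _ <-].
have [K] := lcX (x := x) I; rewrite withinET => xK [cK _].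
have [B oB BK] := (i_emb K°).1 (open_interior K).
have xB : B (i x) by have : K° x by []; rewrite -BK.
suff BiK : B `<=` i @` K.
  rewrite /interior nbhsE; exists B; first by split.
  by apply: subset_trans BiK _; exact: image_subset.
move=> p Bp; apply: contrapT => nKp.
have oBK : open (B `&` ~` (i @` K)).
  by apply: openI => //; rewrite openC; apply: (compact_closed hXh); exact: compact_image.
have [|q [[Bq nKq] [y _ yq]]] := i_dense _ oBK; first by exists p.
apply: nKq; exists y => //; apply: interior_subset.
by rewrite -BK /= yq.
Qed.

Context {R : realType}.
Implicit Types uh vh : Xh -> R.

Lemma extension_le uh vh : continuous uh -> continuous vh ->
  (forall x, uh (i x) <= vh (i x)) -> forall p, uh p <= vh p.
Proof.
move=> cu cv uv p; rewrite -subr_ge0.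
apply: (@closed_dense_range ((fun p => vh p - uh p) @^-1` [set t | 0 <= t])).
  apply: preimage_closed; last exact: closed_ge.
  by move=> q _; apply: cvgB; [exact: cv|exact: cu].
by move=> x /=; rewrite subr_ge0.
Qed.

Lemma extension_unique uh vh : continuous uh -> continuous vh ->
  uh \o i = vh \o i -> uh = vh.
Proof.
move=> cu cv uv; have uvx x : uh (i x) = vh (i x) := congr1 (@^~ x) uv.
apply/funext => p; apply/eqP; rewrite eq_le.
by apply/andP; split; apply: extension_le => // x; rewrite uvx.
Qed.

Lemma compact_support_extension (u : X -> R) uh p : compact_support u ->
  continuous uh -> uh \o i = u -> ~ range i p -> uh p = 0.
Proof.
move=> [cu cs] cuh uhu np; apply: contrapT => /eqP up.
set K := closure _ in cs.
have oU : open ([set q | uh q != 0] `&` ~` (i @` K)).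
  apply: openI.
    by apply: (@open_comp _ _ uh [set t | t != 0]); [move=> q _; exact: cuh|exact: open_neq].
  by rewrite openC; apply: (compact_closed hXh); exact: compact_image.
have [|q [[/= uq nKq] [y _ yq]]] := i_dense _ oU.
  by exists p; split=> // -[x _ xp]; apply: np; exists x.
apply: nKq; exists y => //; apply: subset_closure.
by rewrite /= -uhu /= yq.
Qed.

(** The functions whose extensions agree at [p] and [q] form a closed subalgebra; containing [S], it
    contains the restriction of a function on [Xh] that separates distinct [p] and [q]. Uniform
    estimates pass from [X] to [Xh] by density. *)
Lemma generators_separate (S : set (X -> R)) (p q : Xh) :
  S `<=` @bounded_continuous R X ->
  extendable i = generated_subalgebra S ->
  (forall u uh, S u -> continuous uh -> uh \o i = u -> uh p = uh q) -> p = q.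
Proof.
move=> SB eA pq; apply: contrapT => npq.
have [w [cw wp wq]] := compact_separation (R := R) cXh hXh npq.
pose C := [set u : X -> R | extendable i u /\
  exists uh, [/\ continuous uh, uh \o i = u & uh p = uh q]].
have gA := generated_subalgebra_closed SB; rewrite -eA in gA.
have [Ab Ac AD AM /closed_uniformP clA] := gA.
have clC : closed_subalgebra C.
  split.
  - by move=> u [[]].
  - move=> c; split; first exact: Ac.
    by exists (cst c); split=> // x; exact: cvg_cst.
  - move=> u v [eu [uh [cuh uu upq]]] [ev [vh [cvh vv vpq]]].
    split; first exact: AD.
    exists (uh \+ vh); split; last by rewrite /= upq vpq.
      by move=> x; apply: cvgD; [exact: cuh|exact: cvh].
    by rewrite -uu -vv.
  - move=> u v [eu [uh [cuh uu upq]]] [ev [vh [cvh vv vpq]]].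
    split; first exact: AM.
    exists (uh \* vh); split; last by rewrite /= upq vpq.
      by move=> x; apply: cvgM; [exact: cuh|exact: cvh].
    by rewrite -uu -vv.
  - apply/closed_uniformP => u h.
    have eu : extendable i u by apply: clA => e /h[a [ea _] ua]; exists a.
    split=> //; have [bu [uh cuh uu]] := eu; exists uh; split=> //.
    apply/eqP; rewrite -subr_eq0 -normr_le0; apply/ler_addgt0Pl => e e0; rewrite addr0.
    have [a [ea [ah [cah aa apq]]] ua] := h (e / 2) (divr_gt0 e0 (ltr0Sn _ 1)).
    have uah z : `|uh z - ah z| <= e / 2.
      apply: (@extension_le (fun z => `|uh z - ah z|) (cst (e / 2))).
      - move=> t; apply: cvg_norm; apply: cvgB; [exact: cuh|exact: cah].
      - by move=> t; exact: cvg_cst.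
      - move=> x; apply: ltW; have := ua x.
        by rewrite -uu -aa.
    have -> : uh p - uh q = (uh p - ah p) - (uh q - ah q) by rewrite apq; ring.
    apply: (le_trans (ler_normB _ _)).
    by rewrite [e]splitr; apply: lerD.
have wA : extendable i (w \o i).
  split; last by exists w.
  apply: bounded_continuous_comp => //; split=> //.
  exact: compact_continuous_bounded.
have : C (w \o i).
  move: wA; rewrite eA => wA; apply: wA; split=> // u Su.
  have eu : extendable i u by rewrite eA; exact: sub_generated_subalgebra.
  split=> //; have [_ [uh cuh uu]] := eu; exists uh; split=> //.
  exact: pq Su _ uu.
case=> _ [wh [cwh wwh whpq]].
move: whpq; rewrite (extension_unique cwh cw wwh) wp wq => /eqP.
by rewrite oner_eq0.
Qed.

Variable f : X -> X.

Let H := hat_rel f i.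

Lemma hat_rel_sub x : H (i x, i (f x)).
Proof. by apply: subset_closure; exists (x, f x). Qed.

Lemma hat_rel_map_eq fh : H = graph_of fh -> forall x, fh (i x) = i (f x).
Proof. by move=> HE x; have : H (i x, i (f x)) := @hat_rel_sub x; rewrite HE. Qed.

Lemma hat_rel_continuous :
  (forall u : X -> R, extendable i u -> extendable i (u \o f)) ->
  exists2 fh : Xh -> Xh, continuous fh & H = graph_of fh.
Proof.
move=> Af; have clH : closed H by exact: closed_closure.
have total p : exists q, H (p, q).
  have [] := @closed_dense_range [set p | exists2 q, setT q & H (p, q)] _ _ p.
  - exact: closed_proj.
  - by move=> x; exists (i (f x)) => //; exact: hat_rel_sub.
  - by move=> q _ pq; exists q.
(* If [u] separates [q] from [r] and [v] extends [u \o i \o f], then [v a = u b] for all pairs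
   [(a, b)] of [H], since this holds on the graph of [f] and is a closed condition. *)
have functional p q r : H (p, q) -> H (p, r) -> q = r.
  move=> pq pr; apply: contrapT => nqr.
  have [u [cu uq ur]] := compact_separation (R := R) cXh hXh nqr.
  have [|_ [v cv vu]] := Af (u \o i).
    split; last by exists u.
    apply: bounded_continuous_comp => //; split=> //.
    exact: compact_continuous_bounded.
  have Hvu : H `<=` (fun t => v t.1 - u t.2) @^-1` [set 0 : R].
    have cl0 : closed ((fun t : Xh * Xh => v t.1 - u t.2) @^-1` [set 0 : R]).
      apply: preimage_closed; last by apply: accessible_closed_set1; apply: hausdorff_accessible; exact: Rhausdorff.
      move=> t _; apply: cvgB.
        by apply: continuous_comp; [exact: cvg_fst|exact: cv].
      by apply: continuous_comp; [exact: cvg_snd|exact: cu].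
    move/closure_id : cl0 => ->; apply: closureS => _ [[x y] fxy <-] /=.
    by rewrite -(fxy : f x = y) /=; have := congr1 (@^~ x) vu => /= ->; rewrite subrr.
  have /= := Hvu _ pq; have /= := Hvu _ pr.
  by rewrite uq ur subr0 => ->; move/eqP; rewrite sub0r oppr_eq0 oner_eq0.
have [fh fhH] := choice total.
have HE : H = graph_of fh.
  apply/seteqP; split=> [[p q] pq|[p q] pq]; last by rewrite -(pq : fh p = q).
  exact: functional (fhH p) pq.
exists fh => //; apply/continuous_closedP => C clC.
rewrite (_ : _ @^-1` _ = [set p | exists2 q, C q & H (p, q)]).
  by apply: closed_proj => //; apply: (subclosed_compact clC cXh).
apply/seteqP; split=> p /=; first by exists (fh p).
by case=> q Cq; rewrite HE /= => ->.
Qed.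

End proper_compactification_theory.

(** * Recurrent points of a Lyapunov function cascade compactification *)

Lemma iter_continuous (X : topologicalType) (f : X -> X) n :
  continuous f -> continuous (iter n f).
Proof.
move=> cf; elim: n => [|n IH] x; first exact: cvg_id.
by apply: (@continuous_comp _ _ _ (iter n f) f); [exact: IH|exact: cf].
Qed.

Definition lyapunov_generators (R : realType) (X : topologicalType)
    (f : X -> X) (LL : set (X -> R)) : set (X -> R) :=
  LL `|` [set u | exists n, exists2 v, @compact_support R X v & u = v \o iter n f].

Section lyapunov_cascade.
Context {R : realType} {X Xh : topologicalType} (f : X -> X) (LL : set (X -> R)).
Variable i : X -> Xh.
Hypothesis lcX : locally_compact [set: X].
Hypothesis cf : continuous f.
Hypothesis suff : sufficient_set f LL.
Hypothesis plus : plus_invariant f LL.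

Let S := lyapunov_generators f LL.

Lemma lyapunov_generators_bounded : S `<=` @bounded_continuous R X.
Proof.
move=> u [/suff.1[]//|[n [v cv ->]]].
by apply: bounded_continuous_comp; [exact: iter_continuous|exact: compact_support_bounded].
Qed.

Hypothesis hi : lyapunov_compactification f LL i.

Let pci : proper_compactification i. Proof. by have [] := hi. Qed.
Let eA : extendable i = generated_subalgebra S. Proof. by have [] := hi. Qed.
Let cXh : compact [set: Xh]. Proof. by have [[]] := pci. Qed.
Let hXh : hausdorff_space Xh. Proof. by have [[]] := pci. Qed.
Let i_inj : injective i. Proof. by have [] := pci. Qed.
Let ci : continuous i. Proof. exact: compactification_continuous pci. Qed.

(** Composition with [f] maps generators to generators: [LL] by +invariance, the others by raising
    the index of the iterate. *)
Lemma lyapunov_cascade_compactification : cascade_compactification f i.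
Proof.
apply: (hat_rel_continuous pci (R := R)) => u; rewrite eA.
apply: generated_subalgebra_comp; first exact: lyapunov_generators_bounded.
move=> v Sv; apply: sub_generated_subalgebra.
case: Sv => [Lv|[n [w cw ->]]]; first by left; apply: plus; exists v.
by right; exists n.+1, w => //; apply/funext => x /=; rewrite -iterSr.
Qed.

Variable fh : Xh -> Xh.
Hypothesis cfh : continuous fh.
Hypothesis hatE : hat_rel f i = graph_of fh.

Let G := GG (graph_of fh).

Let fhi x : fh (i x) = i (f x). Proof. exact: (hat_rel_map_eq hatE). Qed.

Let fhi_iter n x : iter n fh (i x) = i (iter n f x).
Proof. by elim: n => //= n ->. Qed.

Lemma tilde_spaceP p : tilde_space f i p <-> exists n, range i (iter n fh p).
Proof.
have iterE n : iter n (rel_preimage (hat_rel f i)) (range i) =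
    [set q | range i (iter n fh q)].
  elim: n => [//|n IH]; rewrite iterS IH hatE.
  apply/seteqP; split=> q; rewrite /rel_preimage /= -iterS iterSr.
    by case=> y ry qy; rewrite (qy : fh q = y).
  by move=> ry; exists (fh q).
split=> [[n _]|[n h]]; first by rewrite iterE; exists n.
by exists n => //; rewrite iterE.
Qed.

Lemma tilde_space_step p : tilde_space f i (fh p) -> tilde_space f i p.
Proof.
by move=> /tilde_spaceP[n h]; apply/tilde_spaceP; exists n.+1; rewrite iterSr.
Qed.

(** By density [Lh] increases along [fh], so the closed transitive relation [Lh p <= Lh q] contains
    the graph of [fh]. *)
Lemma lyapunov_extension L : LL L -> exists2 Lh : Xh -> R,
  continuous Lh /\ Lh \o i = L & forall p q, G (p, q) -> Lh p <= Lh q.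
Proof.
move=> LLL; have : extendable i L.
  by rewrite eA; apply: sub_generated_subalgebra; left.
case=> _ [Lh cLh LhL]; exists Lh => // p q.
apply: (@GG_sub _ _ [set t | Lh t.1 <= Lh t.2] _ _ _ (p, q)).
- rewrite (_ : [set _ | _] = (fun t => Lh t.2 - Lh t.1) @^-1` [set t | 0 <= t]).
    apply: preimage_closed; last exact: closed_ge.
    move=> t _; apply: cvgB; first by apply: continuous_comp; [exact: cvg_snd|exact: cLh].
    by apply: continuous_comp; [exact: cvg_fst|exact: cLh].
  by apply/seteqP; split=> t /=; rewrite subr_ge0.
- by move=> a b c /=; exact: le_trans.
- move=> [a b] ab; rewrite /= -(ab : fh a = b).
  have cLf : continuous (Lh \o fh).
    by move=> t; apply: continuous_comp; [exact: cfh|exact: cLh].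
  apply: (extension_le pci cLh cLf _ a).
  move=> x; rewrite /= fhi; have Lx t : Lh (i t) = L t by rewrite -LhL.
  by rewrite !Lx; have [/(_ _ LLL)[]] := suff.
Qed.

Lemma G_dynamic : [set p | G (i p.1, i p.2)] = GG (graph_of f).
Proof.
have cii : continuous (fun p : X * X => (i p.1, i p.2)).
  move=> p; apply: cvg_pair; apply: continuous_comp;
    by [exact: cvg_fst|exact: cvg_snd|exact: ci].
apply/seteqP; split; last first.
  apply: GG_sub.
  - by apply: preimage_closed; [move=> p _; exact: cii|exact: closed_GG].
  - by move=> x y z /= xy yz; exact: GG_trans xy yz.
  - move=> [x y] xy; rewrite /= -(xy : f x = y) -fhi; exact: GG_graph.
(* Sufficiency describes the union of [GG] with the diagonal, so it decides membership in [GG] only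
   for distinct points. *)
have off_diagonal x y : x <> y -> G (i x, i y) -> GG (graph_of f) (x, y).
  move=> nxy xy; have : (\bigcap_(L in LL) lyapunov_le L) (x, y).
    move=> L /lyapunov_extension[Lh [cLh LhL] /(_ _ _ xy)].
    by rewrite /lyapunov_le /= -LhL.
  by rewrite -suff.2 => -[/diagonalP//|].
move=> [x y] /= xy; have [xyE|/off_diagonal/(_ xy)//] := pselect (x = y).
subst y; have [fxx|nfx] := pselect (f x = x).
  by rewrite -{2}fxx; exact: GG_graph.
(* A recurrent point that is not fixed returns from [f x], and the pair [(f x, x)] is off the
   diagonal. *)
apply: (@GG_trans _ _ x (f x) x); first exact: GG_graph.
apply: off_diagonal => //.
have [fhx|] := GG_first_step cfh hXh xy; last by rewrite fhi.
by exfalso; apply: nfx; apply: i_inj; rewrite -fhi.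
Qed.

Lemma infinity_separated p q : ~ tilde_space f i p -> ~ tilde_space f i q ->
  G (p, q) -> G (q, p) -> p = q.
Proof.
move=> np nq pq qp.
apply: (generators_separate pci lyapunov_generators_bounded eA) => u uh Su cuh uhu.
case: Su => [LLu|[n [v cv uE]]].
  have [Lh [cLh LhL] mono] := lyapunov_extension LLu.
  rewrite (extension_unique pci cuh cLh); last by rewrite uhu LhL.
  by apply/eqP; rewrite eq_le !mono.
have : extendable i v.
  rewrite eA; apply: sub_generated_subalgebra; right; exists 0%N, v => //.
case=> _ [vh cvh vhv].
have -> : uh = vh \o iter n fh.
  apply: (extension_unique pci cuh).
    move=> t; apply: continuous_comp; [exact: iter_continuous|exact: cvh].
  by rewrite uhu uE -vhv; apply/funext => x /=; rewrite fhi_iter.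
have z t : ~ tilde_space f i t -> vh (iter n fh t) = 0.
  move=> nt; apply: (compact_support_extension pci cv cvh vhv) => h.
  by apply: nt; apply/tilde_spaceP; exists n.
by rewrite /= !z.
Qed.

Lemma recurrent_return p : G (p, p) -> G (fh p, p).
Proof.
by move=> pp; have [fp|//] := GG_first_step cfh hXh pp; rewrite {1}fp.
Qed.

(** The image [fh p] never enters [X] either and is equivalent to [p], so the two coincide. *)
Lemma recurrent_infinity_fixed p : G (p, p) -> ~ tilde_space f i p -> fh p = p.
Proof.
move=> pp np; apply/esym; apply: infinity_separated => //.
- by move=> /tilde_space_step.
- exact: GG_graph.
- exact: recurrent_return.
Qed.

Lemma image_fixed_range p n : range i p -> range i (iter n fh p).
Proof. by case=> x _ <-; rewrite fhi_iter; exists (iter n f x). Qed.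

Section class.
Variable e0 : Xh.
Hypothesis e0e0 : G (e0, e0).
Let Eh := [set p | G (p, p) /\ (G (e0, p) /\ G (p, e0))].

Let Eh_G p q : Eh p -> Eh q -> G (p, q).
Proof. by move=> [_ [_ p0]] [_ [q0 _]]; exact: GG_trans p0 q0. Qed.

Let Eh_eq p q : Eh p -> G (p, q) -> G (q, p) -> Eh q.
Proof.
move=> [_ [p0 p1]] pq qp; split; first exact: GG_trans qp pq.
by split; [exact: GG_trans p0 pq|exact: GG_trans qp p1].
Qed.

Let Eh_fh p : Eh p -> Eh (fh p).
Proof.
move=> Ep; apply: (Eh_eq Ep); first exact: GG_graph.
by apply: recurrent_return; case: Ep.
Qed.

(** The last step of a return of [p] to itself starts at a preimage of [p] that is equivalent to
    [p]. *)
Let Eh_surj p : Eh p -> exists2 q, fh q = p & Eh q.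
Proof.
move=> Ep; have [pp _] := Ep.
have [q fq pq] := GG_last_step cfh hXh cXh pp.
exists q => //; case: pq => [<-//|pq]; apply: (Eh_eq Ep pq).
by rewrite -fq; exact: GG_graph.
Qed.

Let closed_Eh : closed Eh.
Proof.
rewrite (_ : Eh = [set p | G (e0, p)] `&` [set p | G (p, e0)]).
  apply: closedI; (apply: (@preimage_closed _ _ (fun p => _)); last exact: closed_GG).
    by move=> p _; apply: cvg_pair; [exact: cvg_cst|exact: cvg_id].
  by move=> p _; apply: cvg_pair; [exact: cvg_id|exact: cvg_cst].
apply/seteqP; split=> p; first by case=> _ [].
by case=> h1 h2; split=> //; exact: GG_trans h2 h1.
Qed.

(** The class is mapped into itself by [fh], so a point of it that enters [X] would put a point into
    the trace. *)
Lemma class_trace_empty : i @^-1` Eh = set0 -> class_at_infinity f i Eh.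
Proof.
move=> E0; have nt p : Eh p -> ~ tilde_space f i p.
  move=> Ep /tilde_spaceP[n [x _ xp]].
  have : Eh (iter n fh p) by elim: n {xp} => //= n; exact: Eh_fh.
  by rewrite -xp => Ex; have : (i @^-1` Eh) x by []; rewrite E0.
exists e0; split=> //.
- apply/seteqP; split=> p; last by move=> ->.
  move=> Ep; apply: infinity_separated; [exact: nt|exact: nt|exact: Eh_G|exact: Eh_G].
- rewrite /rel_fixed /= hatE; apply: recurrent_infinity_fixed => //; exact: nt.
- exact: nt.
Qed.

Let iE_fixed x : Eh (i x) -> rel_fixed (GG (graph_of f)) x.
Proof. by case=> xx _; rewrite /rel_fixed /= -G_dynamic. Qed.

Let iE_class x : Eh (i x) -> GG_class (graph_of f) (i @^-1` Eh).
Proof.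
move=> Ex; exists x; first exact: iE_fixed.
apply/seteqP; split=> y.
  move=> Ey; split; first exact: iE_fixed.
  by split; rewrite /= -G_dynamic; exact: Eh_G.
by case=> _ [/=]; rewrite -G_dynamic /= => xy yx; apply: Eh_eq Ex xy yx.
Qed.

(* By compactness, some [iter N fh] maps [Eh `\` range i] into [range i]; but
   [fh] maps [Eh] onto [Eh] and [range i] into itself, so a point of
   [Eh `\` range i] has an [N]-th preimage there. *)
Lemma class_in_tilde : Eh `<=` tilde_space f i -> i @^-1` Eh !=set0 ->
  class_compact f i Eh.
Proof.
move=> Et [x Ex].
have oR := open_range pci lcX.
have cF : compact (Eh `&` ~` range i).
  apply: (subclosed_compact _ cXh) => //; apply: closedI => //.
  by rewrite closedC.
have Ei : Eh `<=` range i.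
  move=> e Ee; apply: contrapT => ne.
  have /compact_near_coveringP/(_ nat \oo (fun n p => range i (iter n fh p))) := cF.
  case=> [p [Ep _]|N _ hN].
    have /tilde_spaceP[n rn] := Et p Ep.
    exists (iter n fh @^-1` range i, [set m | (n <= m)%N]) => /=.
      split; last by exists n.
      apply: open_nbhs_nbhs; split=> //; apply: open_comp => // q _; exact: iter_continuous.
    move=> [q m] /= [rq nm].
    by rewrite -(subnK nm) iterD; exact: image_fixed_range.
  have [z [Ez nz] ze] : exists2 z, Eh z /\ ~ range i z & iter N fh z = e.
    elim: N {hN} => [|N [z [Ez nz] ze]]; first by exists e.
    have [w wz Ew] := Eh_surj Ez; exists w; last by rewrite iterSr wz.
    split=> // rw; apply: nz; rewrite -wz; exact: (@image_fixed_range w 1).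
  by apply: ne; rewrite -ze; apply: (hN N (leqnn N) z).
split.
- apply/seteqP; split=> p; last by case=> y Ey <-.
  by move=> Ep; have [y _ yp] := Ei p Ep; exists y => //; rewrite /= yp.
- exact: iE_fixed.
- exact: iE_class Ex.
- by apply: (compact_preimage pci) => //; apply: (subclosed_compact closed_Eh cXh).
Qed.

Lemma class_meets_infinity e : Eh e -> ~ tilde_space f i e ->
  i @^-1` Eh !=set0 -> class_noncompact f i Eh.
Proof.
move=> Ee ne [x Ex]; split.
- exact: iE_fixed.
- exact: iE_class Ex.
- move=> cE.
  have clE : closed (i @` (i @^-1` Eh)).
    by apply: (compact_closed hXh); exact: compact_image.
  have clF : closed (Eh `&` ~` range i).
    by apply: closedI => //; rewrite closedC; exact: open_range.
  have EF p : Eh p -> (i @` (i @^-1` Eh)) p \/ (Eh `&` ~` range i) p.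
    move=> Ep; have [[y _ yp]|np] := pselect (range i p); last by right.
    by left; exists y => //; rewrite /= yp.
  have [U [oU EU UF]] : exists U, [/\ open U, i @` (i @^-1` Eh) `<=` U &
      closure U `&` (Eh `&` ~` range i) = set0].
    have nF : set_nbhs (i @` (i @^-1` Eh)) (~` (Eh `&` ~` range i)).
      apply/set_nbhsP; exists (~` (Eh `&` ~` range i)); split=> //.
        by rewrite openC.
      by move=> _ [y _ <-] [_]; apply; exists y.
    have [V hV VF] := compact_normal hXh cXh clE nF.
    have [U [oU EU UV]] := (set_nbhsP _ _).1 hV.
    exists U; split=> //; apply/disjoints_subset.
    by apply: subset_trans VF; exact: closureS.
  pose V := U `&` fh @^-1` U.
  have oV : open V.
    by apply: openI => //; apply: open_comp => // p _; exact: cfh.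
  have EV : i @` (i @^-1` Eh) `<=` V.
    move=> p [y Ey yp]; split; first by apply: EU; exists y.
    apply: EU; exists (f y); first by rewrite /= -fhi; exact: Eh_fh.
    by rewrite -fhi yp.
  pose C := closure U `&` ~` V.
  have cC : compact C.
    apply: (subclosed_compact _ cXh) => //; apply: closedI; first exact: closed_closure.
    by rewrite closedC.
  pose Q := @diagonal Xh `|` G.
  have clQ : closed Q by apply: closedU; [exact: closed_diagonal|exact: closed_GG].
  (* If the trace of [Eh] on [X] were compact, it would have a neighborhood [U]
     whose closure misses the rest of [Eh]. Since [fh] maps [V] into [U], pairs
     of [G] leading from [V] to the outside of [closure U] factor through [C]:
     such pairs form a closed transitive relation. From [i x] to [e], this gives
     a point of [Eh] in [C], where there is none. *)
  pose T := [set p | G p /\ (~ V p.1 \/ closure U p.2 \/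
    exists2 y, C y & Q (p.1, y) /\ Q (y, p.2))].
  have GT : G `<=` T.
    apply: GG_sub.
    - apply: closedI; first exact: closed_GG.
      apply: closedU.
        apply: (@preimage_closed _ _ fst (~` V)); last by rewrite closedC.
        by move=> p _; exact: cvg_fst.
      apply: closedU.
        apply: (@preimage_closed _ _ snd); last exact: closed_closure.
        by move=> p _; exact: cvg_snd.
      apply: (closed_proj (P := [set t : (Xh * Xh) * Xh | Q (t.1.1, t.2) /\ Q (t.2, t.1.2)]) _ cC).
      have c11 : continuous (fun t : (Xh * Xh) * Xh => t.1.1).
        by move=> t; apply: continuous_comp; exact: cvg_fst.
      have c12 : continuous (fun t : (Xh * Xh) * Xh => t.1.2).
        by move=> t; apply: continuous_comp; [exact: cvg_fst|exact: cvg_snd].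
      apply: closedI.
        apply: (@preimage_closed _ _ (fun t : (Xh * Xh) * Xh => (t.1.1, t.2))) => // t _.
        by apply: cvg_pair; [exact: c11|exact: cvg_snd].
      apply: (@preimage_closed _ _ (fun t : (Xh * Xh) * Xh => (t.2, t.1.2))) => // t _.
      by apply: cvg_pair; [exact: cvg_snd|exact: c12].
    (* If [b] is in [closure U] but not in [V], then [b] itself is the intermediate point in [C]; if
       [b] is in [V], the alternatives for [(b, c)] apply. *)
    - move=> a b c [ab abT] [bc bcT]; split; first exact: GG_trans bc.
      have [Va|] := pselect (V a); last by left.
      right; case: abT => [//|[Ub|[y Cy [ay yb]]]]; last first.
        right; exists y => //; split=> //; right.
        by case: yb => [/diagonalP/= ->//|yb]; exact: GG_trans bc.
      have [Vb|nVb] := pselect (V b); last first.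
        by right; exists b => //; split; right.
      case: bcT => [//|[Uc|[y Cy [by_ yc]]]]; first by left.
      right; exists y => //; split=> //; right.
      by case: by_ => [/diagonalP/= <-//|by_]; exact: GG_trans by_.
    - move=> [a b] ab; split; first by apply: sub_GG.
      have [Va|] := pselect (V a); last by left.
      right; left; apply: subset_closure; rewrite /= -(ab : fh a = b).
      by case: Va.
  have rx : (i @` (i @^-1` Eh)) (i x) by exists x.
  have [_ [/=|[/=|]]] := GT (i x, e) (Eh_G Ex Ee).
  + by apply; exact: EV.
  + move=> Ue; have : (closure U `&` (Eh `&` ~` range i)) e.
      split=> //; split=> // re; apply: ne; apply/tilde_spaceP; by exists 0%N.
    by rewrite UF.
  + move=> [y [Uy nVy] /= [xy ye]].
    have xy' : G (i x, y).
      by case: xy => [/diagonalP/= <-|//]; exact: Eh_G.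
    have yx : G (y, i x).
      case: ye => [/diagonalP/= ->|ye]; first exact: Eh_G.
      by apply: GG_trans ye _; exact: Eh_G.
    have Ey := Eh_eq Ex xy' yx.
    case: (EF _ Ey) => [/EV//|Fy].
    have : (closure U `&` (Eh `&` ~` range i)) y by [].
    by rewrite UF.
- exists e.
    by rewrite /rel_fixed /= hatE; apply: recurrent_infinity_fixed => //; case: Ee.
  apply/seteqP; split=> p; last by move=> ->.
  by case=> Ep np; apply: infinity_separated => //; exact: Eh_G.
Qed.

End class.
End lyapunov_cascade.

(** * Proper maps, homeomorphisms and the single parts of the theorem *)

Lemma compact_support_comp (R : realType) (X : topologicalType) (f : X -> X)
    (u : X -> R) : hausdorff_space X -> proper_map f -> compact_support u ->
  compact_support (u \o f).
Proof.
move=> hX [cf pf] [cu cs]; split.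
  by move=> x; apply: continuous_comp; [exact: cf|exact: cu].
apply: (subclosed_compact _ (pf _ cs)); first exact: closed_closure.
have clK : closed (f @^-1` closure [set x | u x != 0]).
  by apply: (compact_closed hX); exact: pf.
rewrite [X in _ `<=` X](closure_id _).1//; apply: closureS => x ux.
exact: subset_closure.
Qed.

Lemma homeomorphism_proper (X : topologicalType) (f : X -> X) :
  homeomorphism f -> proper_map f.
Proof.
move=> [cf [g [cg fg gf]]]; split=> // K cK.
rewrite (_ : _ @^-1` _ = g @` K).
  by apply: continuous_compact => //; exact: continuous_subspaceT.
apply/seteqP; split=> [x fx|_ [y Ky <-]]; first by exists (f x).
by rewrite /= gf.
Qed.

Lemma proper_lyapunov_generators (R : realType) (X : topologicalType)
    (f : X -> X) (LL : set (X -> R)) : hausdorff_space X -> proper_map f ->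
  lyapunov_generators f LL = LL `|` @compact_support R X.
Proof.
move=> hX pf; apply/seteqP; split=> u [|]; try by left.
  move=> [n [v cv ->]]; right; elim: n => [//|n IH].
  rewrite (_ : v \o _ = (v \o iter n f) \o f); first exact: compact_support_comp.
  by apply/funext => x; rewrite /= -iterSr.
by move=> cu; right; exists 0%N, u.
Qed.

Section parts.
Context {R : realType} {X : topologicalType} (f : X -> X) (LL : set (X -> R)).
Hypothesis lcX : locally_compact [set: X].
Hypothesis hX : hausdorff_space X.
Hypothesis cf : continuous f.
Hypothesis suff : sufficient_set f LL.

Let LLb : LL `<=` @bounded_continuous R X.
Proof. by move=> u /suff.1[]. Qed.

Lemma lyapunov_compactification_exists :
  exists (Xh : topologicalType) (i : X -> Xh), lyapunov_compactification f LL i.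
Proof.
apply: compactification_exists => //.
  by apply: generated_subalgebra_closed; exact: lyapunov_generators_bounded.
move=> u cu; apply: sub_generated_subalgebra; right; by exists 0%N, u.
Qed.

(** The cases exclude one another: an equivalence class is nonempty, and a trace is either compact
    or not. *)
Lemma exactly_one_class (Xh : topologicalType) (i : X -> Xh) (Eh : set Xh) :
  [\/ class_at_infinity f i Eh, class_noncompact f i Eh | class_compact f i Eh] ->
  exactly_one (class_at_infinity f i Eh) (class_noncompact f i Eh)
              (class_compact f i Eh).
Proof.
have ne : GG_class (graph_of f) (i @^-1` Eh) -> i @^-1` Eh = set0 -> False.
  move=> [x xx ->] E0; have : set0 x by rewrite -E0; split.
  by [].
have h12 : class_at_infinity f i Eh -> ~ class_noncompact f i Eh.
  by move=> [_ [_ _ _ E0]] [_ + _ _] => /ne; apply.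
have h13 : class_at_infinity f i Eh -> ~ class_compact f i Eh.
  by move=> [_ [_ _ _ E0]] [_ _ + _] => /ne; apply.
have h23 : class_noncompact f i Eh -> ~ class_compact f i Eh.
  by move=> [_ _ nc _] [_ _ _ c].
case=> h; [apply: Or31|apply: Or32|apply: Or33]; split=> //.
- exact: h12.
- exact: h13.
- by move=> /h12.
- exact: h23.
- by move=> /h13.
- by move=> /h23.
Qed.

Section plus_invariant.
Hypothesis plus : plus_invariant f LL.
Context {Xh : topologicalType} (i : X -> Xh).
Hypothesis hi : lyapunov_compactification f LL i.

Lemma lyapunov_compactification_dynamic :
  [/\ cascade_compactification f i, dynamic_compactification f i &
      rel_fixed (GG (hat_rel f i)) `&` ~` tilde_space f i
        `<=` rel_fixed (hat_rel f i)].
Proof.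
have cc := lyapunov_cascade_compactification cf suff plus hi.
have [fh cfh hatE] := cc; split=> //.
  split; first by case: hi.
  by rewrite hatE; exact: (G_dynamic suff hi cfh hatE).
move=> p [pp np]; rewrite /rel_fixed /= hatE.
rewrite /rel_fixed /= hatE in pp.
exact: (recurrent_infinity_fixed cf suff hi cfh hatE).
Qed.

Lemma lyapunov_compactification_classes (Eh : set Xh) : GG_class (hat_rel f i) Eh ->
  exactly_one (class_at_infinity f i Eh) (class_noncompact f i Eh)
              (class_compact f i Eh).
Proof.
have [fh cfh hatE] := lyapunov_cascade_compactification cf suff plus hi.
rewrite hatE => -[e0 e0e0 ->]; apply: exactly_one_class.
set Eh' := [set y | _].
have [E0|/eqP/set0P E0] := pselect (i @^-1` Eh' = set0).
  by apply: Or31; exact: (class_trace_empty cf suff hi cfh hatE e0e0).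
have [Et|] := pselect (Eh' `<=` tilde_space f i).
  by apply: Or33; exact: (class_in_tilde lcX suff hi cfh hatE (e0 := e0) Et E0).
move=> /existsNP[e /not_implyP[Ee ne]].
by apply: Or32; exact: (class_meets_infinity lcX cf suff hi cfh hatE (e0 := e0) Ee ne E0).
Qed.

Lemma proper_lyapunov_compactification : proper_map f ->
  range i = tilde_space f i /\ L_compactification LL i.
Proof.
move=> pf; split; last first.
  by rewrite /L_compactification -(proper_lyapunov_generators LL hX pf).
have [pci eA] := hi.
have [fh cfh hatE] := lyapunov_cascade_compactification cf suff plus hi.
have ext u : compact_support u -> exists2 uh : Xh -> R, continuous uh & uh \o i = u.
  move=> cu; suff [_] : extendable i u by [].
  by rewrite eA; apply: sub_generated_subalgebra; right; exists 0%N, u.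
(* Take a bump [u] at [x]. As [f] is proper, [u \o f] has compact support, so its extension
   [uh \o fh] vanishes at [p] outside [X]; but its value there is [u x = 1]. *)
have back p : range i (fh p) -> range i p.
  move=> [x _ xp]; apply: contrapT => np.
  have [u cu [ux _]] := compact_support_bump (R := R) lcX hX openT (I : setT x).
  have [uh cuh uhu] := ext u cu.
  have : (uh \o fh) p = 0.
    apply: (compact_support_extension pci (compact_support_comp hX pf cu)) => //.
      by move=> t; apply: continuous_comp; [exact: cfh|exact: cuh].
    apply/funext => t; rewrite /= (hat_rel_map_eq hatE).
    by rewrite -uhu.
  rewrite /= -xp; have -> : uh (i x) = u x by rewrite -uhu.
  by rewrite ux => /eqP; rewrite oner_eq0.
apply/seteqP; split=> p; first by exists 0%N.
move=> /(tilde_spaceP hatE p)[n]; elim: n => //= n IH /back; exact: IH.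
Qed.

End plus_invariant.

(** Each member of [LL] is [v \o f] with [v] in [LL], so [LL] is also stable under composition with
    the inverse of [f]. Hence both maps extend, and the extensions are inverse to each other by
    density. *)
Lemma L_compactification_reversible : homeomorphism f -> star_invariant f LL ->
  forall (Xh : topologicalType) (i : X -> Xh),
    L_compactification LL i -> reversible_cascade_compactification f i.
Proof.
move=> hf star Xh i [pci eA].
have pf := homeomorphism_proper hf.
have [_ [g [cg fg gf]]] := hf.
have pg : proper_map g by apply: homeomorphism_proper; split=> //; exists f.
have [[cXh hXh] _ _ _] := pci.
have Sb : LL `|` @compact_support R X `<=` @bounded_continuous R X.
  by move=> u [/LLb//|]; exact: compact_support_bounded.
have [|fh cfh fhE] := hat_rel_continuous pci (R := R) (f := f).
  rewrite eA; apply: generated_subalgebra_comp => // u Su.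
  apply: sub_generated_subalgebra; case: Su => [Lu|cu].
    by left; rewrite -star; exists u.
  by right; exact: compact_support_comp.
have [|gh cgh ghE] := hat_rel_continuous pci (R := R) (f := g).
  rewrite eA; apply: generated_subalgebra_comp => // u Su.
  apply: sub_generated_subalgebra; case: Su => [|cu].
    rewrite -{1}star => -[v Lv <-]; left; rewrite (_ : _ \o _ = v)//.
    by apply/funext => x /=; rewrite gf.
  by right; exact: compact_support_comp.
have cancel_ext (a b : Xh -> Xh) : continuous a -> continuous b ->
    (forall x, b (a (i x)) = i x) -> cancel a b.
  move=> ca cb ab; apply: (closed_dense_range pci (C := [set p | b (a p) = p])) => //.
  rewrite (_ : [set _ | _] = (fun p => (b (a p), p)) @^-1` @diagonal Xh).
    apply: preimage_closed; last exact: closed_diagonal.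
    move=> p _; apply: cvg_pair; last exact: cvg_id.
    by apply: continuous_comp; [exact: ca|exact: cb].
  by apply/seteqP; split=> p /diagonalP.
exists fh => //; split=> //; exists gh; split=> //.
  by apply: cancel_ext => // x; rewrite (hat_rel_map_eq fhE) (hat_rel_map_eq ghE) fg.
by apply: cancel_ext => // x; rewrite (hat_rel_map_eq ghE) (hat_rel_map_eq fhE) gf.
Qed.

End parts.

(** * Existence of Lyapunov functions *)

(** [L] vanishes on the points below [y] and is at least 1 on those above [x]; these two sets are
    disjoint by transitivity. *)
Lemma monotone_separation (R : realType) (X : topologicalType) (P : set (X * X))
    (x y : X) : lc_sigma_compact_hausdorff X -> closed P ->
  (forall z, P (z, z)) -> rel_transitive P -> ~ P (x, y) ->
  exists L : X -> R, [/\ bounded_continuous L,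
    forall a b, P (a, b) -> L a <= L b & L y < L x].
Proof.
move=> [lcX scX hX] clP rP tP nxy.
have [|||||L [cL mL L02 L0 L1]] := @ordered_urysohn_lower R X P
  (lower_interpolation lcX scX hX clP rP tP)
  [set z | P (z, y)] (~` [set z | P (x, z)]).
- by apply: (@preimage_closed _ _ (fun z => (z, y))) => // z _;
    apply: cvg_pair; [exact: cvg_id|exact: cvg_cst].
- by move=> a b /= ab; exact: tP.
- rewrite openC; apply: (@preimage_closed _ _ (fun z => (x, z))) => // z _.
  by apply: cvg_pair; [exact: cvg_cst|exact: cvg_id].
- by move=> a b /= ab nb xa; apply: nb; exact: tP ab.
- by move=> z /= zy xz; apply: nxy; exact: tP zy.
exists L; split=> //.
  split=> //; apply/bounded_funE; exists 2 => z.
  by have /andP[h1 h2] := L02 z; rewrite ger0_norm.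
rewrite (L0 y) /=; last exact: rP.
by apply: (lt_le_trans ltr01); apply: L1; apply; exact: rP.
Qed.

Section lyapunov_functions.
Context {R : realType} {X : topologicalType} (f : X -> X).
Hypothesis hX : lc_sigma_compact_hausdorff X.

Let Q := @diagonal X `|` GG (graph_of f).

Lemma lyapunov_fun_monotone (L : X -> R) : lyapunov_fun f L -> Q `<=` lyapunov_le L.
Proof.
move=> [[cL _] mono]; have sG : GG (graph_of f) `<=` lyapunov_le L.
  apply: GG_sub.
  - rewrite (_ : lyapunov_le L = (fun t => L t.2 - L t.1) @^-1` [set t | 0 <= t]).
      apply: preimage_closed; last exact: closed_ge.
      move=> t _; apply: cvgB; first by apply: continuous_comp; [exact: cvg_snd|exact: cL].
      by apply: continuous_comp; [exact: cvg_fst|exact: cL].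
    by apply/seteqP; split=> t /=; rewrite subr_ge0.
  - by move=> a b c; exact: le_trans.
  - by move=> [a b] ab; rewrite /lyapunov_le /= -(ab : f a = b).
by move=> [a b] [/diagonalP/= ->|/sG//]; exact: lexx.
Qed.

Lemma sufficient_separation (LL : set (X -> R)) : LL `<=` lyapunov_fun f ->
  (forall x y, ~ Q (x, y) -> exists2 L, LL L & L y < L x) ->
  sufficient_set f LL.
Proof.
move=> LLf sep; split=> //; apply/seteqP; split=> [p Qp L /LLf Lf|[x y] h].
  exact: lyapunov_fun_monotone.
apply: contrapT => /sep[L LLL]; rewrite ltNge => /negP; apply.
exact: h.
Qed.

Lemma lyapunov_functions_separate x y : ~ Q (x, y) ->
  exists2 L : X -> R, lyapunov_fun f L & L y < L x.
Proof.
have [_ _ h] := hX; move=> nQ.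
have [|||L [bL mL Lyx]] := @monotone_separation R X Q x y hX _ _ _ nQ.
- by apply: closedU; [exact: closed_diagonal|exact: closed_GG].
- by move=> z; left; apply/diagonalP.
- move=> a b c [/diagonalP/= ->//|ab] [/diagonalP/= <-|bc]; right=> //.
  exact: GG_trans bc.
exists L => //; split=> // z; apply: mL; right; exact: sub_GG.
Qed.

End lyapunov_functions.

(** * Countable subcovers and F-sigma sets *)

Section countable_subcover.
Context {Z : topologicalType} {I J : choiceType}.
Variables (D : set I) (O : I -> set Z) (C : J -> set Z) (W : set Z).
Hypothesis oO : forall i, D i -> open (O i).

Lemma compact_finite_subcover (K : set Z) : compact K ->
  K `<=` \bigcup_(i in D) O i ->
  exists A, [/\ finite_set A, A `<=` D & K `<=` \bigcup_(i in A) O i].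
Proof.
move=> /compact_near_coveringP cov KO.
pose F := filter_from [set A | finite_set A /\ A `<=` D]
  (fun A => [set B : set I | A `<=` B]).
have FF : Filter F.
  apply: filter_from_filter; first by exists set0; split; [exact: finite_set0|exact: sub0set].
  move=> A B [fA AD] [fB BD]; exists (A `|` B).
    by split; [rewrite finite_setU|rewrite subUset].
  by move=> E /=; rewrite subUset.
have [z Kz|A [fA AD] hA] := cov _ F (fun B z => (\bigcup_(i in B) O i) z) FF.
  have [i Di Oiz] := KO z Kz.
  exists (O i, [set B | [set i] `<=` B]) => /=.
    split; first by apply: open_nbhs_nbhs; split=> //; exact: oO.
    by exists [set i] => //; split; [exact: finite_set1|move=> _ ->].
  by move=> [z' B] /= [Oz' iB]; exists i => //; exact: iB.
by exists A; split=> //; exact: (hA A (@subset_refl _ A)).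
Qed.

Lemma sigma_compact_countable_subcover : countable [set: J] ->
  (forall j, compact (C j)) -> W = \bigcup_j C j ->
  W `<=` \bigcup_(i in D) O i ->
  exists A, [/\ countable A, A `<=` D & W `<=` \bigcup_(i in A) O i].
Proof.
move=> cJ cC WC WO.
have h j : exists A, [/\ finite_set A, A `<=` D & C j `<=` \bigcup_(i in A) O i].
  by apply: compact_finite_subcover => // z Cz; apply: WO; rewrite WC; exists j.
have [A AP] := choice h.
exists (\bigcup_j A j); split.
- by apply: bigcup_countable => // j _; apply: finite_set_countable; have [] := AP j.
- by move=> i [j _]; have [_ AD _] := AP j; exact: AD.
- rewrite WC => z [j _]; have [_ _ CA] := AP j; move=> /CA[i Ai Oiz].
  by exists i => //; exists j.
Qed.

End countable_subcover.

(** [W] is exhausted by the points that stay about [1 / (m + 1)] away from its complement. Interiors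
    are taken because a ball need not be open. *)
Lemma pseudometric_open_Fsigma (R : realType) (Y : pseudoMetricType R) (W : set Y) :
  open W -> exists E : nat -> set Y, (forall m, closed (E m)) /\ W = \bigcup_m E m.
Proof.
move=> oW; pose B (m : nat) (q : Y) := (ball q (m.+1%:R^-1 : R))°.
exists (fun m => ~` \bigcup_(q in ~` W) B m q); split.
  by move=> m; rewrite closedC; apply: bigcup_open => q _; exact: open_interior.
apply/seteqP; split=> p.
  have := oW; rewrite openE => /[apply]; rewrite /interior => /nbhs_ballP[e /= e0 eW].
  have [m _ /(_ m (leqnn m)) me] := near_infty_natSinv_lt (PosNum e0).
  exists m => // -[q nWq /interior_subset/ball_sym qp]; apply/nWq/eW.
  exact: le_ball (ltW me) _ qp.
move=> [m _ nB]; apply: contrapT => nWp; apply: nB; exists p => //.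
by apply: nbhsx_ballx; rewrite invr_gt0.
Qed.

(** * Metrizability *)

(** An F-sigma decomposition in the metric model is cut down by the squares of an exhaustion of [X].
    This gives the Lindelof property for open subsets of [X * X]. *)
Lemma metrizable_open_sigma_compact (R : realType) (X : topologicalType)
    (W : set (X * X)) : metrizable R X -> sigma_compact X -> open W ->
  exists C : nat * nat -> set (X * X), (forall j, compact (C j)) /\
    W = \bigcup_j C j.
Proof.
move=> [M [h [ch [g [cg hg gh]]]]] scX oW.
have [K [cK incK KT]] := increasing_compact_cover scX.
pose gg (p : M * M) := (g p.1, g p.2); pose hh (p : X * X) := (h p.1, h p.2).
have cgg : continuous gg.
  by move=> p; apply: cvg_pair; apply: continuous_comp;
    by [exact: cvg_fst|exact: cvg_snd|exact: cg].
have chh : continuous hh.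
  by move=> p; apply: cvg_pair; apply: continuous_comp;
    by [exact: cvg_fst|exact: cvg_snd|exact: ch].
have [|E [cE WE]] := @pseudometric_open_Fsigma R (M * M)%type (gg @^-1` W).
  by apply: open_comp => // p _; exact: cgg.
exists (fun j => (K j.1 `*` K j.1) `&` hh @^-1` E j.2); split.
  move=> [n m]; apply: compact_closedI; first exact: compact_setX.
  by apply: preimage_closed => //= p _; exact: chh.
have WEp p : W p = (\bigcup_m E m) (hh p).
  by rewrite -WE /gg /hh /= !hg; case: p.
apply/seteqP; split=> [[x y]|[x y] [[n m] _ [_ Ep]]]; rewrite WEp; last by exists m.
move=> [m _ Em].
have Kex z : exists n, K n z by have : setT z by []; rewrite -KT => -[n]; exists n.
have [[n Kx] [k Ky]] := (Kex x, Kex y); exists (maxn n k, m) => //; split=> //.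
by split=> /=; [apply: incK Kx; exact: leq_maxl|apply: incK Ky; exact: leq_maxr].
Qed.

Section sequence_metric.
Context {R : realType} {T : topologicalType} (w : nat -> T -> R).
Hypothesis cw : forall k, continuous (w k).
Hypothesis w_bound : forall k x, `|w k x| <= 2^-1 ^+ k.
Hypothesis w_sep : forall x y, (forall k, w k x = w k y) -> x = y.

Let dset x y := range (fun k => `|w k x - w k y|).
Let d x y : R := sup (dset x y).

Let w_dist k x y : `|w k x - w k y| <= 2 * 2^-1 ^+ k.
Proof. by rewrite (le_trans (ler_normB _ _))// mulr_natl mulr2n lerD. Qed.

Let d_sup x y : has_sup (dset x y).
Proof.
split; first by exists `|w 0 x - w 0 y|; exists 0%N.
exists 2 => _ [k _ <-]; apply: (le_trans (w_dist k x y)).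
by rewrite ler_piMr// exprn_ile1// invf_le1// ler1n.
Qed.

Let le_d k x y : `|w k x - w k y| <= d x y.
Proof. by apply: ub_le_sup; [case: (d_sup x y)|exists k]. Qed.

Let d_le x y e : (forall k, `|w k x - w k y| <= e) -> d x y <= e.
Proof. by move=> h; apply: ge_sup; [case: (d_sup x y)|move=> _ [k _ <-]]. Qed.

Let dxx x : d x x = 0.
Proof.
apply/eqP; rewrite eq_le; apply/andP; split.
  by apply: d_le => k; rewrite subrr normr0.
exact: le_trans (le_d 0 x x).
Qed.

Let d_positivity x y : d x y = 0 -> x = y.
Proof.
move=> d0; apply: w_sep => k; apply/eqP; rewrite -subr_eq0 -normr_le0 -d0.
exact: le_d.
Qed.

Let d_sym x y : d x y = d y x.
Proof.
by apply/eqP; rewrite eq_le; apply/andP; split; apply: d_le => k;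
  rewrite distrC; exact: le_d.
Qed.

Let d_triangle y x z : d x z <= d x y + d y z.
Proof.
apply: d_le => k; apply: le_trans (lerD (le_d k x y) (le_d k y z)).
exact: ler_distD.
Qed.

(* The [let]s make the alias depend on the data defining its distance. *)
Definition sequence_metric_space : Type :=
  let _ := w_bound in let _ := w_sep in T.
HB.instance Definition _ := Choice.on sequence_metric_space.
HB.instance Definition _ := isMetric.Build R sequence_metric_space
  dxx d_positivity d_sym d_triangle.

(** Because of the bound [2^-1 ^+ k], only finitely many of the functions matter at a given scale,
    so the identity is continuous; its inverse is continuous because a compact space is mapped to a
    Hausdorff one. *)
Lemma sequence_metric_homeomorphism : compact [set: T] ->
  homeomorphism (id : T -> sequence_metric_space).
Proof.
move=> cT; have cid : continuous (id : T -> sequence_metric_space).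
  move=> x; apply/cvg_ballP => e e0.
  have e2 : 0 < e / 2 by rewrite divr_gt0.
  have [N NP] : exists N, forall k, (N <= k)%N -> 2 * 2^-1 ^+ k < e / 2 :> R.
    have e4 : 0 < e / 4 by rewrite divr_gt0.
    have [N _ hN] := near_infty_natSinv_expn_lt (PosNum e4).
    exists N => k /hN /=; rewrite div1r exprVn; lra.
  have small k : \forall y \near x, `|w k x - w k y| < e / 2.
    by have /cvgrPdist_lt := @cw k x; exact.
  have fin : \forall y \near x, forall k, (k < N)%N -> `|w k x - w k y| < e / 2.
    elim: N {NP} => [|N IH]; first by apply: nearW.
    have := small N; apply: filterS2 IH => y h1 h2 k.
    by rewrite ltnS leq_eqVlt => /predU1P[->//|]; exact: h1.
  apply: filterS fin => y h; rewrite ballEmdist /=.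
  apply: (@le_lt_trans _ _ (e / 2)); last by lra.
  apply: d_le => k; have [kN|Nk] := ltnP k N; first by apply/ltW/h.
  by apply: (le_trans (w_dist k x y)); apply/ltW/NP.
split=> //; exists id; split=> //.
apply/continuous_closedP => C clC.
apply: compact_closed; first exact: metric_hausdorff.
rewrite (_ : _ @^-1` _ = (id : T -> sequence_metric_space) @` C); last first.
  by rewrite image_id.
apply: continuous_compact; first exact: continuous_subspaceT.
exact: (subclosed_compact clC cT).
Qed.

End sequence_metric.

Lemma compact_metrizable (R : realType) (T : topologicalType)
    (D : set (T -> R)) : compact [set: T] -> countable D ->
  (forall u, D u -> continuous u) ->
  (forall x y, (forall u, D u -> u x = u y) -> x = y) -> metrizable R T.
Proof.
move=> cT cD Dc Dsep.
have [v vP] : exists v : nat -> T -> R, (forall k, continuous (v k)) /\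
    forall u, D u -> exists k, v k = u.
  have /countable_injP[phi phi_inj] := cD.
  (* Indices that [phi] does not attain receive the zero function, so that a finite or empty [D] is
     enumerated too. *)
  have h k : exists u : T -> R, continuous u /\
      forall u', D u' -> phi u' = k -> u' = u.
    have [[u Du uk]|nu] := pselect (exists2 u, D u & phi u = k).
      exists u; split; first exact: Dc.
      by move=> u' Du'; rewrite -uk => /phi_inj; apply; rewrite inE.
    exists (cst 0); split; first by move=> x; exact: cvg_cst.
    by move=> u' Du' uk; exfalso; apply: nu; exists u'.
  have [v vP] := choice h; exists v; split=> [k|u Du]; first by have [] := vP k.
  by exists (phi u); have [_ /(_ u Du erefl)] := vP (phi u).
have bnd k : exists M : R, forall x, `|v k x| <= M.
  by apply/bounded_funE; apply: compact_continuous_bounded => //; exact: vP.1.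
have [M MP] := choice bnd.
(* The factor turns the bound [M k] into [2^-1 ^+ k]; the added 1 keeps the denominator positive. *)
pose c k : R := 2^-1 ^+ k / (`|M k| + 1).
have M0 k : 0 < `|M k| + 1 by rewrite ltr_wpDl.
have c0 k : 0 < c k by rewrite divr_gt0// exprn_gt0.
pose w k x := c k * v k x.
have cw k : continuous (w k).
  by move=> x; apply: cvgM; [exact: cvg_cst|exact: vP.1].
have w_bound k x : `|w k x| <= 2^-1 ^+ k.
  rewrite /w normrM (gtr0_norm (c0 k)) /c -mulrA ler_piMr ?exprn_ge0//.
  rewrite mulrC ler_pdivrMr// mul1r (le_trans (MP k x))//.
  by rewrite (le_trans (ler_norm _))// lerDl.
have w_sep x y : (forall k, w k x = w k y) -> x = y.
  move=> xy; apply: Dsep => u /vP.2[k <-].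
  by have /mulfI := xy k; apply; rewrite gt_eqF.
exists (sequence_metric_space w_bound w_sep), id.
exact: sequence_metric_homeomorphism.
Qed.

Lemma countable_setU (T : Type) (A B : set T) :
  countable A -> countable B -> countable (A `|` B).
Proof.
move=> cA cB; have -> : A `|` B = \bigcup_(b in [set: bool]) (if b then A else B).
  by apply/seteqP; split=> [x [|]|x [[]]]; [exists true|exists false|left|right].
by apply: bigcup_countable => // -[].
Qed.

(** * Families stable under [f] and its inverse *)

Section orbits.
Context {R : realType} {X : topologicalType} (f g : X -> X) (LL : set (X -> R)).
Hypothesis cf : continuous f.
Hypothesis cg : continuous g.
Hypothesis fg : forall x, f (g x) = g (f x).

(* Applied with [g] the inverse of [f], or with [g = id] if there is none. *)
Definition orbit_set : set (X -> R) :=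
  \bigcup_n \bigcup_k [set u \o iter n f \o iter k g | u in LL].

Let iter_comm k x : f (iter k g x) = iter k g (f x).
Proof. by elim: k => //= k IH; rewrite fg IH. Qed.

(** The members stay Lyapunov functions because [g] commutes with [f]; the family contains [LL], so
    it separates at least as much. *)
Lemma orbit_set_sufficient : sufficient_set f LL -> sufficient_set f orbit_set.
Proof.
move=> [LLf eq]; have orb : orbit_set `<=` @lyapunov_fun R X f.
  move=> _ [n _ [k _ [u Lu <-]]]; have [bu mono] := LLf u Lu; split.
    apply: bounded_continuous_comp; first exact: iter_continuous.
    by apply: bounded_continuous_comp => //; exact: iter_continuous.
  by move=> x /=; rewrite -iter_comm -iterSr iterS.
apply: sufficient_separation => // x y nQ.
have : ~ (\bigcap_(L in LL) lyapunov_le L) (x, y) by rewrite -eq.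
move=> /existsNP[L /not_implyP[LLL]]; rewrite /lyapunov_le /= => /negP.
by rewrite -ltNge => Lyx; exists L => //; exists 0%N => //; exists 0%N => //; exists L.
Qed.

Lemma orbit_set_plus_invariant : plus_invariant f orbit_set.
Proof.
move=> _ [_ [n _ [k _ [u Lu <-]]] <-].
exists n.+1 => //; exists k => //; exists u => //.
by apply/funext => x /=; rewrite -iter_comm -iterSr iterS.
Qed.

(** One more factor [g] compensates the composition with [f], so every member is the image of a
    member. *)
Lemma orbit_set_star_invariant : cancel f g -> star_invariant f orbit_set.
Proof.
move=> fgK; apply/seteqP; split; first exact: orbit_set_plus_invariant.
move=> _ [n _ [k _ [u Lu <-]]].
exists (u \o iter n f \o iter k.+1 g); first by exists n => //; exists k.+1 => //; exists u.
by apply/funext => x; rewrite [LHS]/= -iterS iterSr fgK.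
Qed.

Lemma countable_orbit_set : countable LL -> countable orbit_set.
Proof.
move=> cL; apply: bigcup_countable => // n _; apply: bigcup_countable => // k _.
by apply: sub_countable cL; exact: card_image_le.
Qed.

End orbits.

(** * Countable families and metrizability of the compactification *)

Section metrizable_compactification.
Context {R : realType} {X : topologicalType} (f : X -> X).
Hypothesis hX : lc_sigma_compact_hausdorff X.
Hypothesis mX : metrizable R X.

Let lcX : locally_compact [set: X]. Proof. by have [] := hX. Qed.
Let scX : sigma_compact X. Proof. by have [] := hX. Qed.
Let haX : hausdorff_space X. Proof. by have [] := hX. Qed.

Lemma metrizable_countable_subcover (I : choiceType) (D : set I)
    (O : I -> set (X * X)) (W : set (X * X)) : open W ->
  (forall i, D i -> open (O i)) -> W `<=` \bigcup_(i in D) O i ->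
  exists A, [/\ countable A, A `<=` D & W `<=` \bigcup_(i in A) O i].
Proof.
move=> oW oO WO; have [C [cC WC]] := metrizable_open_sigma_compact mX scX oW.
exact: (sigma_compact_countable_subcover oO (countableP _) cC WC WO).
Qed.

(** The open sets where [L y < L x], over all Lyapunov functions [L], cover the complement of the
    preorder; a countable subcover gives the family. *)
Lemma countable_sufficient_set : exists2 LL : set (X -> R),
  sufficient_set f LL & countable LL.
Proof.
have oQ : open (~` (@diagonal X `|` GG (graph_of f))).
  by rewrite openC; apply: closedU; [exact: closed_diagonal|exact: closed_GG].
have [||A [cA AD QA]] := @metrizable_countable_subcover _ (@lyapunov_fun R X f)
  (fun L => [set p | L p.2 < L p.1]) _ oQ.
- move=> L [[cL _] _].
  rewrite (_ : [set _ | _] = (fun p => L p.1 - L p.2) @^-1` [set t | 0 < t]).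
    apply: open_comp; last exact: open_gt.
    move=> p _; apply: cvgB; first by apply: continuous_comp; [exact: cvg_fst|exact: cL].
    by apply: continuous_comp; [exact: cvg_snd|exact: cL].
  by apply/seteqP; split=> p /=; rewrite subr_gt0.
- move=> [x y] /(lyapunov_functions_separate (R := R) hX)[L LL Lxy].
  by exists L.
exists A => //; apply: sufficient_separation => // x y /QA[L AL Lxy].
by exists L.
Qed.

(** The last clause serves to tell points of [X] from points outside [X], where extensions of these
    functions vanish. *)
Lemma countable_compact_support_separation : exists D : set (X -> R),
  [/\ countable D, D `<=` @compact_support R X,
      forall x y, x <> y -> exists2 u, D u & u x <> u y &
      forall x, exists2 u, D u & u x <> 0].
Proof.
have oN : open (~` @diagonal X) by rewrite openC; exact: closed_diagonal.
have [||D1 [cD1 D1c D1s]] := @metrizable_countable_subcover _ (@compact_support R X)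
  (fun u => [set p | u p.1 != u p.2]) _ oN.
- move=> u [cu _].
  rewrite (_ : [set _ | _] = (fun p => u p.1 - u p.2) @^-1` [set t | t != 0]).
    apply: open_comp; last exact: open_neq.
    move=> p _; apply: cvgB; first by apply: continuous_comp; [exact: cvg_fst|exact: cu].
    by apply: continuous_comp; [exact: cvg_snd|exact: cu].
  by apply/seteqP; split=> p /=; rewrite subr_eq0.
- move=> [x y] /= xy; have {}xy : x <> y by move=> h; apply/xy/diagonalP.
  have [|u cu [ux uy]] := @compact_support_bump R X x (~` [set y]) lcX haX _ xy.
    by rewrite openC; apply: (compact_closed haX); exact: compact_set1.
  by exists u => //=; rewrite ux uy ?oner_neq0//; apply.
have [K cK KT] := scX.
have oO (u : X -> R) : compact_support u -> open [set x | u x != 0].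
  move=> [cu _]; apply: (@open_comp _ _ u [set t | t != 0]); last exact: open_neq.
  by move=> x _; exact: cu.
have [||D2 [cD2 D2c D2s]] := sigma_compact_countable_subcover oO (countableP _) cK
  (W := setT).
- by rewrite KT.
- move=> x _; have [u cu [ux _]] := compact_support_bump (R := R) lcX haX openT (I : setT x).
  by exists u => //=; rewrite ux oner_neq0.
exists (D1 `|` D2); split.
- exact: countable_setU.
- by move=> u [/D1c|/D2c].
- move=> x y xy; have [|u Du /= /eqP uxy] := D1s (x, y); first by move/diagonalP.
  by exists u => //; left.
- by move=> x; have [//|u Du /= /eqP ux] := D2s x; exists u => //; right.
Qed.

Context {Xh : topologicalType} (LL : set (X -> R)) (i : X -> Xh).
Hypothesis cf : continuous f.
Hypothesis suff : sufficient_set f LL.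
Hypothesis plus : plus_invariant f LL.
Hypothesis cLL : countable LL.

(** Countably many functions separate points: [LL] and the [u \o iter n f] with [u] in the countable
    [D]. If they agree at [p] and [q], then the [n]-th iterates are either both outside [X], where
    extensions of compactly supported functions vanish, or equal points of [X]; so all generators
    agree. *)
Lemma lyapunov_compactification_metrizable :
  lyapunov_compactification f LL i -> metrizable R Xh.
Proof.
move=> hi; have [pci eA] := hi; have [[cXh hXh] i_inj _ _] := pci.
have [fh cfh hatE] := lyapunov_cascade_compactification cf suff plus hi.
have [D [cD Dc Dsep Dne]] := countable_compact_support_separation.
pose E := LL `|` \bigcup_n [set u \o iter n f | u in D].
have cE : countable E.
  apply: countable_setU => //; apply: bigcup_countable => // n _.
  by apply: sub_countable cD; exact: card_image_le.
pose Eh := [set uh : Xh -> R | continuous uh /\ E (uh \o i)].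
have ext u : compact_support u -> exists2 uh : Xh -> R, continuous uh & uh \o i = u.
  move=> cu; suff [_] : extendable i u by [].
  by rewrite eA; apply: sub_generated_subalgebra; right; exists 0%N, u.
apply: (@compact_metrizable R Xh Eh) => //.
(* Restriction to the dense image of [X] is injective on continuous functions, so [Eh] is no larger
   than [E]. *)
- have /countable_injP[phi phi_inj] := cE; apply/countable_injP.
  exists (fun uh => phi (uh \o i)) => u v; rewrite !inE => -[cu Eu] [cv Ev] uv.
  by apply: (extension_unique pci cu cv); apply: phi_inj; rewrite ?inE.
- by move=> u [].
move=> p q pq; apply: (generators_separate pci (lyapunov_generators_bounded cf suff) eA).
move=> u uh Su cuh uhu; case: Su => [Lu|[n [v cv uE]]].
  by apply: pq; split=> //; rewrite uhu; left.
have [vh cvh vhv] := ext v cv.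
have iter_ext (w : X -> R) wh : wh \o i = w ->
    (wh \o iter n fh) \o i = w \o iter n f.
  move=> <-; apply/funext => x /=; congr wh.
  by elim: n {uE} => //= m ->; rewrite (hat_rel_map_eq hatE).
have cw wh : continuous wh -> continuous (wh \o iter n fh : Xh -> R).
  by move=> c t; apply: continuous_comp; [exact: iter_continuous|exact: c].
have -> : uh = vh \o iter n fh.
  apply: (extension_unique pci cuh (cw _ cvh)).
  by rewrite uhu uE (iter_ext v).
have agree w wh : D w -> continuous wh -> wh \o i = w ->
    wh (iter n fh p) = wh (iter n fh q).
  move=> Dw cwh whw; have := pq (wh \o iter n fh); apply; split; first exact: cw.
  by right; exists n => //; exists w => //; rewrite (iter_ext w).
have outside a b : (forall w wh, D w -> continuous wh -> wh \o i = w -> wh a = wh b) ->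
    range i a -> range i b.
  move=> ab [x _ xa]; apply: contrapT => nb.
  have [w Dw wx] := Dne x; have [wh cwh whw] := ext w (Dc _ Dw).
  apply: wx; rewrite -whw /= xa (ab w wh)//.
  exact: (compact_support_extension pci (Dc _ Dw) cwh whw nb).
rewrite /=; move: agree; set a := iter n fh p; set b := iter n fh q => agree.
have [ra|na] := pselect (range i a); last first.
  have nb : ~ range i b.
    move=> rb; apply/na/(outside b a) => // w wh Dw cwh whw.
    by rewrite (agree w wh).
  by rewrite !(compact_support_extension pci cv cvh vhv).
have rb := outside a b agree ra.
move: ra rb => [x _ xa] [y _ yb]; congr vh; rewrite -xa -yb.
congr i; apply: contrapT => xy; have [w Dw] := Dsep x y xy; apply.
have [wh cwh whw] := ext w (Dc _ Dw).
by have := agree w wh Dw cwh whw; rewrite -xa -yb -whw.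
Qed.

End metrizable_compactification.

(** A single family must serve both properties at once: countability is arranged first if [X] is
    metrizable, and passing to the orbit preserves it. *)
Lemma lyapunov_compactification_metrizable_reversible (R : realType) (X : topologicalType) (f : X -> X) :
  lc_sigma_compact_hausdorff X -> continuous f ->
  exists (LL : set (X -> R)) (Xh : topologicalType) (i : X -> Xh),
     [/\ sufficient_set f LL, plus_invariant f LL,
         lyapunov_compactification f LL i,
         metrizable R X -> metrizable R Xh &
         homeomorphism f -> reversible_cascade_compactification f i].
Proof.
move=> hX cf; have [lcX _ haX] := hX.
have [g [cg fg fgK]] : exists g : X -> X, [/\ continuous g,
    forall x, f (g x) = g (f x) & homeomorphism f -> cancel f g].
  have [[_ [g [cg fg gf]]]|nf] := pselect (homeomorphism f).
    by exists g; split=> // x; rewrite fg gf.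
  by exists id; split=> // x; exact: cvg_id.
have [LL suff cLL] : exists2 LL : set (X -> R),
    sufficient_set f LL & metrizable R X -> countable LL.
  have [mX|nmX] := pselect (metrizable R X).
    by have [LL suff cLL] := countable_sufficient_set f hX mX; exists LL.
  exists (lyapunov_fun f) => //; apply: sufficient_separation => // x y.
  exact: lyapunov_functions_separate.
have suffO := orbit_set_sufficient cf cg fg suff.
have plusO := orbit_set_plus_invariant (LL := LL) fg.
have [Xh [i hi]] := lyapunov_compactification_exists lcX haX cf suffO.
exists (orbit_set f g LL), Xh, i; split=> //.
- move=> mX; apply: (lyapunov_compactification_metrizable hX mX cf suffO plusO _ hi).
  by apply: countable_orbit_set; exact: cLL.
- move=> hf; have starO := orbit_set_star_invariant LL fg (fgK hf).
  have [_] := proper_lyapunov_compactification lcX haX cf suffO plusO hi (homeomorphism_proper hf).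
  exact: L_compactification_reversible.
Qed.

Theorem theorem2p14 (R : realType) (X : topologicalType) (f : X -> X)
    (hX : lc_sigma_compact_hausdorff X) (hf : continuous f) :
  (forall LL : set (X -> R), sufficient_set f LL -> plus_invariant f LL ->
    (* the associated compactification exists *)
    [/\ exists (Xh : topologicalType) (i : X -> Xh),
          lyapunov_compactification f LL i,
        forall (Xh : topologicalType) (i : X -> Xh),
          lyapunov_compactification f LL i ->
          [/\ (* (a) *)
              [/\ cascade_compactification f i, dynamic_compactification f i &
                  rel_fixed (GG (hat_rel f i)) `&` ~` tilde_space f i
                    `<=` rel_fixed (hat_rel f i)],
              (* (b) *)
              forall Eh : set Xh, GG_class (hat_rel f i) Eh ->
                exactly_one (class_at_infinity f i Eh)
                            (class_noncompact f i Eh)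
                            (class_compact f i Eh) &
              (* (c) *)
              proper_map f -> range i = tilde_space f i /\ L_compactification LL i] &
        (* (d) *)
        homeomorphism f -> star_invariant f LL ->
        forall (Xh : topologicalType) (i : X -> Xh),
          L_compactification LL i -> reversible_cascade_compactification f i])
  /\
  (* (e) *)
  (metrizable R X \/ homeomorphism f ->
   exists (LL : set (X -> R)) (Xh : topologicalType) (i : X -> Xh),
     [/\ sufficient_set f LL, plus_invariant f LL,
         lyapunov_compactification f LL i,
         metrizable R X -> metrizable R Xh &
         homeomorphism f -> reversible_cascade_compactification f i]).
Proof.
have [lcX _ haX] := hX; split; last by move=> _; exact: lyapunov_compactification_metrizable_reversible.
move=> LL suff plus; split.
- exact: lyapunov_compactification_exists.
- move=> Xh i hi; split.
  + exact: (lyapunov_compactification_dynamic hf suff plus hi).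
  + by move=> Eh; exact: (lyapunov_compactification_classes lcX hf suff plus hi).
  + exact: (proper_lyapunov_compactification lcX haX hf suff plus hi).
- exact: L_compactification_reversible.
Qed.
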